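(* As $n \to \infty$, $r^{\mathrm{bip}}_3(C_{2n}) = (3+o(1))n$; that is, $\lim_{n\to\infty} r^{\mathrm{bip}}_3(C_{2n})/n = 3$.
   Context: $C_{2n}$ denotes the cycle on $2n$ vertices. For a bipartite graph $H$ and a positive integer $k$, the $k$-colour bipartite Ramsey number $r^{\mathrm{bip}}_k(H)$ is the least integer $N$ such that every colouring of the edges of the complete bipartite graph $K_{N,N}$ with $k$ colours contains a monochromatic copy of $H$ (as a not necessarily induced subgraph). *)

(* Defs.v *)
From HB Require Import structures.
From mathcomp Require Import all_boot all_order all_algebra.
From mathcomp Require Import all_classical all_reals all_analysis.

Set Implicit Arguments.
Unset Strict Implicit.
Unset Printing Implicit Defensive.

Local Open Scope classical_set_scope.

Record sgraph := SGraph {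
  vertex :> finType;
  adj : rel vertex;
  adj_sym : symmetric adj;
  adj_irr : irreflexive adj }.

(* Not necessarily induced: only edges have to be preserved. *)
Definition has_copy (H G : sgraph) : Prop :=
  exists f : H -> G, injective f /\ {homo f : u v / adj u v}.

(* The cyclic successor on 'I_m is ordS; this is the cycle C_m for m >= 3
   (for m = 2 it degenerates to a single edge). *)
Definition cycle_adj (m : nat) : rel 'I_m :=
  [rel i j | (i != j) && ((j == ordS i) || (i == ordS j))].

Lemma cycle_adj_sym m : symmetric (@cycle_adj m).
Proof. by move=> i j; rewrite /cycle_adj /= eq_sym orbC. Qed.

Lemma cycle_adj_irr m : irreflexive (@cycle_adj m).
Proof. by move=> i; rewrite /cycle_adj /= eqxx. Qed.

Definition cycle_graph (m : nat) : sgraph :=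
  SGraph (@cycle_adj_sym m) (@cycle_adj_irr m).

(* K_{N,N} has vertex set 'I_N + 'I_N, and its edges {inl x, inr y} are indexed
   by the pairs (x, y), so c (x, y) is the colour of the edge {inl x, inr y}. *)
Definition colouring (N k : nat) := 'I_N * 'I_N -> 'I_k.

Definition colour_adj (N k : nat) (c : colouring N k) (a : 'I_k) :
    rel ('I_N + 'I_N) :=
  fun u v => match u, v with
  | inl x, inr y | inr y, inl x => c (x, y) == a
  | _, _ => false
  end.

Lemma colour_adj_sym N k (c : colouring N k) a : symmetric (colour_adj c a).
Proof. by move=> [x|y] [x'|y']. Qed.

Lemma colour_adj_irr N k (c : colouring N k) a : irreflexive (colour_adj c a).
Proof. by move=> [x|y]. Qed.

Definition colour_class (N k : nat) (c : colouring N k) (a : 'I_k) : sgraph :=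
  SGraph (colour_adj_sym c a) (colour_adj_irr c a).

Definition bip_arrows (N k : nat) (H : sgraph) : Prop :=
  forall c : colouring N k, exists a : 'I_k, has_copy H (colour_class c a).

(* Totalized with value 0 when no such N exists. *)
Definition bip_ramsey (k : nat) (H : sgraph) : nat :=
  xget 0%N [set N | bip_arrows N k H /\
                    forall M, bip_arrows M k H -> (N <= M)%N].

Lemma bip_ramseyP (k : nat) (H : sgraph) (N : nat) : bip_arrows N k H ->
  bip_arrows (bip_ramsey k H) k H /\
  forall M, bip_arrows M k H -> (bip_ramsey k H <= M)%N.
Proof.
move=> hN; rewrite /bip_ramsey; case: xgetP => [M _ //|none].
have ex : exists M, `[< bip_arrows M k H >] by exists N; apply/asboolP.
case: (ex_minnP ex) => M /asboolP hM minM.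
by case: (none M); split=> // M' hM'; apply: minM; apply/asboolP.
Qed.

(* Main.v *)
(* Lower bound: split one side of K_{3(n-1),3(n-1)} into three parts of size n-1
   and colour each edge by the part of its endpoint there; the 2n-cycle would
   need n vertices in one part.

   Upper bound (Luczak's connected matching method). Regularise the colouring of
   K_{N,N}, N >= (3 + 1/r) n, and give each pair of clusters a colour in which it
   is lower regular (few pairs have none). Each colour then has a reduced graph
   on the clusters. If the cluster pairs of one component of one reduced graph
   carry a matching of n vertex pairs, then a closed walk of length 2n in that
   component, running back and forth along the cluster pairs of the matching,
   lifts greedily to a monochromatic cycle of length 2n.

   Otherwise, by Koenig's theorem, each component of each colour has a vertex
   cover of fewer than n vertices. An edge xy of colour c forces x and y to lie
   in the same c-component, with x or y in its cover. Three covers together are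
   smaller than one side and six are smaller than both sides, so there is always
   a vertex outside any three (or six) given covers, and the edges at the
   vertices found so far restrict which components it can lie in. A finite case
   analysis of this kind shows that all vertices of one side which lie in the
   cover for colour c only belong to one c-component. Hence there are fewer
   than about 3n vertices covered in a single colour, and every other vertex is
   covered twice; but a minimum cover in one colour has at most N vertices, and
   counting gives a contradiction. *)

Require Import Defs.
From mathcomp Require Import all_boot all_order all_algebra.
From mathcomp Require Import zify ring lra.
From mathcomp Require Import boolp.

Set Implicit Arguments.
Unset Strict Implicit.
Unset Printing Implicit Defensive.

(** * Koenig's theorem *)

Definition matching (A B : finType) (M : {set A * B}) :=
  {in M &, injective fst} /\ {in M &, injective snd}.

Definition edge_cover (A B : finType) (E : {set A * B}) (P : {set A})
    (Q : {set B}) :=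
  forall e, e \in E -> (e.1 \in P) || (e.2 \in Q).

(* Uncrossing: from covers of E minus e and of E minus f, the pairs
   (P1 cap P2, Q1 cup Q2) and (x, P1 cup P2, Q1 cap Q2) cover E, and one of
   them is too small. *)
Lemma critical_fst (A B : finType) (E : {set A * B}) (n : nat) :
  (forall P Q, edge_cover E P Q -> n <= #|P| + #|Q|) ->
  (forall e, e \in E -> exists P Q, edge_cover (E :\ e) P Q /\ #|P| + #|Q| < n) ->
  {in E &, injective fst}.
Proof.
move=> cov crit [x y] [x' z] eE fE /= exx'; subst x'.
apply/eqP; case: eqP => // /eqP nef; exfalso.
have [P1 [Q1 [c1 s1]]] := crit _ eE.
have [P2 [Q2 [c2 s2]]] := crit _ fE.
have xP1 : x \notin P1.
  apply/negP => xP; suff : n <= #|P1| + #|Q1| by lia.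
  apply: cov => e eE'; case: (eqVneq e (x, y)) => [->|ne]; first by rewrite xP.
  by apply: c1; rewrite !inE ne.
have xP2 : x \notin P2.
  apply/negP => xP; suff : n <= #|P2| + #|Q2| by lia.
  apply: cov => e eE'; case: (eqVneq e (x, z)) => [->|ne]; first by rewrite xP.
  by apply: c2; rewrite !inE ne.
have yQ2 : y \in Q2.
  by move: (c2 (x, y)); rewrite !inE eE nef (negbTE xP2) /= => ->.
have zQ1 : z \in Q1.
  by move: (c1 (x, z)); rewrite !inE fE eq_sym nef (negbTE xP1) /= => ->.
have c12 e : e \in E -> e != (x, y) -> e != (x, z) ->
  ((e.1 \in P1) || (e.2 \in Q1)) && ((e.1 \in P2) || (e.2 \in Q2)).
  by move=> eE' n1 n2; rewrite c1 ?inE ?n1 // c2 ?inE ?n2.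
have b1 : n <= #|P1 :&: P2| + #|Q1 :|: Q2|.
  apply: cov => e eE'; rewrite !inE.
  case: (eqVneq e (x, y)) => [->|n1] /=; first by rewrite yQ2 !orbT.
  case: (eqVneq e (x, z)) => [->|n2] /=; first by rewrite zQ1 !orbT.
  by have := c12 _ eE' n1 n2; do 4!case: (_ \in _).
have b2 : n <= #|x |: (P1 :|: P2)| + #|Q1 :&: Q2|.
  apply: cov => e eE'; rewrite !inE.
  case: (eqVneq e (x, y)) => [->|n1] /=; first by rewrite eqxx.
  case: (eqVneq e (x, z)) => [->|n2] /=; first by rewrite eqxx.
  by have := c12 _ eE' n1 n2; do 4!case: (_ \in _); rewrite ?orbT.
have := cardsUI P1 P2; have := cardsUI Q1 Q2.
have : #|x |: (P1 :|: P2)| <= #|P1 :|: P2|.+1.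
  by rewrite cardsU1; case: (_ \notin _) => //=; rewrite add0n.
lia.
Qed.

(** Induction on the number of edges. If some edge can be deleted without creating a cover smaller
    than [n], delete it. Otherwise [E] is critical and, by uncrossing on both sides, is itself a
    matching. *)
Lemma koenig (A B : finType) (E : {set A * B}) (n : nat) :
  (forall P Q, edge_cover E P Q -> n <= #|P| + #|Q|) ->
  exists M : {set A * B}, [/\ M \subset E, matching M & n <= #|M|].
Proof.
move: {2}#|E|.+1 (ltnSn #|E|) => m; elim: m E => // m IH E leE cov.
case: (pselect (exists2 e, e \in E &
  forall P Q, edge_cover (E :\ e) P Q -> n <= #|P| + #|Q|)) => [[e eE h]|crit].
  have [|M [sM mM nM]] := IH (E :\ e) _ h.
    by move: leE; rewrite (cardsD1 e) eE; lia.
  by exists M; split => //; apply: subset_trans sM (subsetDl _ _).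
have crit' e : e \in E -> exists P Q, edge_cover (E :\ e) P Q /\ #|P| + #|Q| < n.
  move=> eE; apply: contrapT => nex; apply: crit; exists e => // P Q c.
  by rewrite leqNgt; apply/negP => lt; apply: nex; exists P, Q.
exists E; split=> //.
  split; first exact: critical_fst cov crit'.
  pose sw (p : A * B) := (p.2, p.1).
  pose E' : {set B * A} := [set p | (p.2, p.1) \in E].
  have cv (F : {set A * B}) P Q :
      edge_cover [set p | (p.2, p.1) \in F] Q P <-> edge_cover F P Q.
    split=> c [x y]; rewrite ?inE => h.
      by have := c (y, x); rewrite inE /= orbC => ->.
    by have := c (y, x) h; rewrite orbC.
  have inj : {in E' &, injective fst}.
    apply: (@critical_fst _ _ _ n) => [P Q /cv|[y x]].
      by rewrite addnC; exact: cov.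
    rewrite inE /= => /crit' [P [Q [c lt]]]; exists Q, P.
    split; last by rewrite addnC.
    have -> : E' :\ (y, x) = [set p | (p.2, p.1) \in E :\ (x, y)].
      by apply/setP => -[y' x']; rewrite !inE /= !xpair_eqE (andbC (y' == y)).
    exact/cv.
  move=> [x y] [x' y'] h h' /= e.
  have := inj (y, x) (y', x'); rewrite !inE /= => /(_ h h' e) [-> ->] //.
(* The left ends of all edges form a cover. *)
apply: leq_trans (cov (fst @: E) set0 _) _; last by rewrite cards0 addn0 leq_imset_card.
by move=> e eE; rewrite imset_f.
Qed.

(** * Covers of the monochromatic components *)

(* The type of a vertex: for each colour c < 3, a name for its component in
   colour c, and a boolean which is false only if the vertex is known not to be
   in the cover of that component. *)
Definition vtype := (seq nat * seq bool)%type.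
Definition tlab (u : vtype) (c : nat) := nth 0 u.1 c.
Definition tcov (u : vtype) (c : nat) := nth false u.2 c.

(** Necessary for an edge between vertices of these types. Unknown membership in a cover counts as
    [true], so no actual edge is ruled out. *)
Definition tcompat (u w : vtype) :=
  has (fun c => (tlab u c == tlab w c) && (tcov u c || tcov w c)) (iota 0 3).

(* The least informative type with labels ls of a vertex in the cover of none of
   the components in C; a component is a pair (colour, name). *)
Definition avoiding (C : seq (nat * nat)) (ls : seq nat) : vtype :=
  (ls, [seq (c, nth 0 ls c) \notin C | c <- iota 0 3]).

(* The names in use for colour c are the i < nth 0 k c, and nth 0 k c itself
   stands for any component without a name. *)
Definition all_labels (k : seq nat) : seq (seq nat) :=
  [seq x :: l | x <- iota 0 (nth 0 k 0).+1,
     l <- [seq [:: y; z] | y <- iota 0 (nth 0 k 1).+1,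
                           z <- iota 0 (nth 0 k 2).+1]].

Definition avoiders (C : seq (nat * nat)) (k : seq nat) (opp : seq vtype) :=
  [seq u <- [seq avoiding C ls | ls <- all_labels k] | all (tcompat u) opp].

(** A label equal to [nth 0 k c] introduces one new name for colour [c]; a smaller one leaves the
    number of names unchanged. *)
Definition bump_names (k : seq nat) (u : vtype) :=
  [seq maxn (nth 0 k c) (tlab u c).+1 | c <- iota 0 3].

Inductive side := LeftSide | RightSide | BothSides.

(* Cert s C ts: the covers of the components in C are too small to contain all
   the common neighbours of the vertices known so far on side s (or on both
   sides); ts treats the possible types of a new vertex outside these covers. *)
Inductive certificate := Cert of side & seq (nat * nat) & seq certificate.

(** A branch closes when no candidate type is left. The bounds 3 and 6 reflect that a cover has
    fewer than [n] vertices over both sides, while each side offers at least [3 * n] common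
    neighbours. *)
Fixpoint valid (t : certificate) (k : seq nat) (us ws : seq vtype) : bool :=
  let: Cert s C ts := t in
  let fix go (ts : seq certificate) (l r : seq vtype) {struct ts} : bool :=
    match ts with
    | [::] => nilp l && nilp r
    | t' :: ts' =>
      match l, r with
      | u :: l', _ => valid t' (bump_names k u) (u :: us) ws && go ts' l' r
      | [::], w :: r' => valid t' (bump_names k w) us (w :: ws) && go ts' [::] r'
      | [::], [::] => true
      end
    end in
  (size C <= if s is BothSides then 6 else 3) &&
  all (fun s => (s.1 < 3) && (s.2 < nth 0 k s.1)) C &&
  go ts (if s is RightSide then [::] else avoiders C k ws)
        (if s is LeftSide then [::] else avoiders C k us).

Fixpoint height (t : certificate) : nat :=
  let: Cert _ _ ts := t in (foldr maxn 0 (map height ts)).+1.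

(** * Types of actual vertices *)

Definition covered (X : finType) (I : eqType) (SX : {set X})
    (lx : nat -> X -> I) (Tx : nat -> pred X) c i :=
  [set x in SX | (lx c x == i) && Tx c x].

Definition named (I : eqType) (k : seq nat) (nm : nat -> nat -> I) :=
  forall c i j, c < 3 -> i < nth 0 k c -> j < nth 0 k c -> nm c i = nm c j -> i = j.

Definition has_type (X : finType) (I : eqType) (SX : {set X})
    (lx : nat -> X -> I) (Tx : nat -> pred X) k nm (x : X) (u : vtype) :=
  x \in SX /\
  forall c, c < 3 -> [/\ tlab u c < nth 0 k c, lx c x = nm c (tlab u c) &
    Tx c x -> tcov u c].

Definition hits (X : finType) (I : eqType) (lx : nat -> X -> I)
    (Tx : nat -> pred X) (nm : nat -> nat -> I) (C : seq (nat * nat)) x :=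
  has (fun s => (lx s.1 x == nm s.1 s.2) && Tx s.1 x) C.

Section OneSide.
Variables (X : finType) (I : eqType) (SX : {set X}).
Variables (lx : nat -> X -> I) (Tx : nat -> pred X).
Notation covered := (covered SX lx Tx).
Notation hits := (hits lx Tx).

Lemma card_hits nm C (Y : {set X}) : Y \subset SX ->
  (forall x, x \in Y -> hits nm C x) ->
  #|Y| <= \sum_(s <- C) #|covered s.1 (nm s.1 s.2)|.
Proof.
elim: C Y => [|s C IH] Y sY hY.
  rewrite big_nil leqn0 cards_eq0; apply/eqP/setP => x; rewrite inE.
  by apply/negP => /hY.
rewrite big_cons -(cardsID (covered s.1 (nm s.1 s.2)) Y) leq_add //.
  by apply: subset_leq_card; apply: subsetIr.
apply: IH => [|x]; first by apply: subset_trans sY; apply: subsetDl.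
rewrite inE => /andP[xC xY]; have := hY x xY; rewrite /hits /=.
case/orP => // h; move: xC; rewrite inE h (subsetP sY) //.
Qed.

(** If the component of [x] has no name yet, [find] returns the length [nth 0 k c], which is exactly
    the fresh label. *)
Definition label_index k (nm : nat -> nat -> I) x c :=
  find (fun i => nm c i == lx c x) (iota 0 (nth 0 k c)).

Definition label_indices k nm x :=
  [seq label_index k nm x c | c <- iota 0 3].

Definition extend_names (k : seq nat) (nm : nat -> nat -> I) x c i :=
  if i < nth 0 k c then nm c i else lx c x.

Lemma label_index_le k nm x c : label_index k nm x c <= nth 0 k c.
Proof. by rewrite -[X in _ <= X](size_iota 0) find_size. Qed.

Lemma label_indexP k nm x c : label_index k nm x c < nth 0 k c ->
  nm c (label_index k nm x c) = lx c x.
Proof.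
rewrite -{1}(size_iota 0 (nth 0 k c)) -has_find => h.
have := nth_find 0 h; rewrite nth_iota; last first.
  by rewrite -{2}(size_iota 0 (nth 0 k c)) -has_find.
by move/eqP.
Qed.

Lemma label_index_new k nm x c i : label_index k nm x c = nth 0 k c ->
  i < nth 0 k c -> nm c i != lx c x.
Proof.
move=> e lt; apply/negP => h.
have : has (fun i => nm c i == lx c x) (iota 0 (nth 0 k c)).
  by apply/hasP; exists i; rewrite ?mem_iota.
by rewrite has_find size_iota -/(label_index k nm x c) e ltnn.
Qed.

Variables (k : seq nat) (nm : nat -> nat -> I) (C : seq (nat * nat)) (x : X).
Hypothesis Cok : all (fun s => (s.1 < 3) && (s.2 < nth 0 k s.1)) C.
Hypothesis nmP : named k nm.
Hypothesis xSX : x \in SX.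
Hypothesis noth : ~~ hits nm C x.
Let u := avoiding C (label_indices k nm x).
Let k' := bump_names k u.
Let nm' := extend_names k nm x.

Lemma tlab_new c : c < 3 -> tlab u c = label_index k nm x c.
Proof. by case: c => [|[|[|]]]. Qed.

Lemma nth_bump_names c : c < 3 ->
  nth 0 k' c = maxn (nth 0 k c) (label_index k nm x c).+1.
Proof. by move=> h; rewrite -tlab_new //; case: c h => [|[|[|]]]. Qed.

Lemma extend_old c i : i < nth 0 k c -> nm' c i = nm c i.
Proof. by rewrite /nm' /extend_names => ->. Qed.

Lemma extend_label c : nm' c (label_index k nm x c) = lx c x.
Proof.
rewrite /nm' /extend_names; case: ifP => // h; exact: label_indexP.
Qed.

(** A label is fresh only if the component of [x] differs from all named ones, so no two names
    collide. *)
Lemma named_extend : named k' nm'.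
Proof.
move=> c i j c3; rewrite !nth_bump_names // => li lj.
have le := label_index_le k nm x c.
case: (ltnP i (nth 0 k c)) => hi; case: (ltnP j (nth 0 k c)) => hj.
- by rewrite !extend_old //; exact: nmP.
- rewrite extend_old //.
  have ej : j = label_index k nm x c by lia.
  rewrite ej extend_label => /eqP; rewrite (negbTE (label_index_new _ hi)) //; lia.
- rewrite (extend_old hj).
  have ei : i = label_index k nm x c by lia.
  rewrite ei extend_label => /esym/eqP; rewrite (negbTE (label_index_new _ hj)) //; lia.
- lia.
Qed.

Lemma has_type_new : has_type SX lx Tx k' nm' x u.
Proof.
split=> // c c3; split.
- by rewrite nth_bump_names // tlab_new // leq_max ltnSn orbT.
- by rewrite tlab_new // extend_label.
- move=> Tc; have -> : tcov u c = ((c, label_index k nm x c) \notin C).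
    by case: c c3 {Tc} => [|[|[|]]].
  (* A component listed in [C] has an old name, so this name denotes the actual component of [x];
     being covered there contradicts [noth]. *)
  apply/negP => inC; move/hasPn: noth => /(_ _ inC) /=.
  have /andP[_ /= lt] := allP Cok _ inC.
  by rewrite Tc andbT (label_indexP lt) eqxx.
Qed.

Lemma has_type_extend (Y : finType) (SY : {set Y}) ly Ty y w :
  has_type SY ly Ty k nm y w -> has_type SY ly Ty k' nm' y w.
Proof.
move=> [ySY h]; split=> // c c3; have [lt e T] := h c c3; split=> //.
  by rewrite nth_bump_names // leq_max lt.
by rewrite e extend_old.
Qed.

Lemma mem_avoiders ws : (forall w, w \in ws -> tcompat u w) ->
  u \in avoiders C k ws.
Proof.
move=> cw; rewrite mem_filter; apply/andP; split; first exact/allP.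
apply: map_f; apply/allpairsP.
exists (label_index k nm x 0, [:: label_index k nm x 1; label_index k nm x 2]).
split; [by rewrite mem_iota ltnS label_index_le| |by []].
apply/allpairsP; exists (label_index k nm x 1, label_index k nm x 2).
by split; rewrite ?mem_iota ?ltnS ?label_index_le.
Qed.
End OneSide.

Lemma tcompatC u w : tcompat u w = tcompat w u.
Proof. by apply: eq_has => c; rewrite eq_sym orbC. Qed.

(** * Soundness of certificates *)

Section Core.
Variables (A B : finType) (I : eqType) (SA : {set A}) (SB : {set B}).
Variables (la : nat -> A -> I) (lb : nat -> B -> I).
Variables (Ta : nat -> pred A) (Tb : nat -> pred B) (E : A -> B -> bool).
Variables (n d D : nat).

Hypothesis compat : forall x y, x \in SA -> y \in SB -> E x y ->
  exists c, [/\ c < 3, la c x = lb c y & Ta c x || Tb c y].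
Hypothesis cover_small : forall c i, c < 3 ->
  #|covered SA la Ta c i| + #|covered SB lb Tb c i| < n.
Hypothesis missA : forall x, x \in SA -> #|[set y in SB | ~~ E x y]| <= d.
Hypothesis missB : forall y, y \in SB -> #|[set x in SA | ~~ E x y]| <= d.
Hypothesis sizeA : 3 * n + D * d <= #|SA|.
Hypothesis sizeB : 3 * n + D * d <= #|SB|.

Lemma type_compat k nm x y u w : named k nm -> E x y ->
  has_type SA la Ta k nm x u -> has_type SB lb Tb k nm y w -> tcompat u w.
Proof.
move=> nmP Exy [xSA hx] [ySB hy].
have [c [c3 e T]] := compat xSA ySB Exy.
have [lu eu Tu] := hx c c3; have [lw ew Tw] := hy c c3.
apply/hasP; exists c; first by rewrite mem_iota.
rewrite (nmP c _ _ c3 lu lw) -?eu -?ew // eqxx /=.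
by case/orP: T => [/Tu|/Tw] ->; rewrite ?orbT.
Qed.

Lemma common_nbrs (X Y : finType) (SX : {set X}) (F : X -> Y -> bool) (ys : seq Y) :
  (forall y, y \in ys -> #|[set x in SX | ~~ F x y]| <= d) ->
  #|SX| <= #|[set x in SX | all (F x) ys]| + size ys * d.
Proof.
elim: ys => [|y ys IH] h /=.
  by rewrite addn0; apply: subset_leq_card; apply/subsetP => x xS; rewrite inE xS.
have {}IH := IH (fun z zys => h z (mem_behead (s := y :: ys) zys)).
have hy := h y (mem_head _ _).
have : #|[set x in SX | all (F x) ys]| <=
   #|[set x in SX | F x y && all (F x) ys]| + #|[set x in SX | ~~ F x y]|.
  apply: leq_trans (leq_card_setU _ _); apply: subset_leq_card.
  by apply/subsetP => x; rewrite !inE => /andP[-> ->]; rewrite andbT; case: (F x y).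
lia.
Qed.

Lemma sum_cover_small (C : seq (nat * nat)) nm : all (fun s => s.1 < 3) C ->
  \sum_(s <- C) #|covered SA la Ta s.1 (nm s.1 s.2)| +
  \sum_(s <- C) #|covered SB lb Tb s.1 (nm s.1 s.2)| <= size C * n.-1.
Proof.
elim: C => [|s C IH]; first by rewrite !big_nil.
move=> /= /andP[s3 /IH]; rewrite !big_cons.
have := cover_small (nm s.1 s.2) s3; lia.
Qed.

(** Unfolds the inner loop of [valid], with the checks on the children abstracted to [vl] and [vr]:
    every candidate type receives a valid child of bounded height. *)
Lemma valid_step (go : seq certificate -> seq vtype -> seq vtype -> bool)
    (vl vr : certificate -> vtype -> bool) :
  (forall ts l r, go ts l r = match ts with
    | [::] => nilp l && nilp r
    | t' :: ts' =>
      match l, r with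
      | u :: l', _ => vl t' u && go ts' l' r
      | [::], w :: r' => vr t' w && go ts' [::] r'
      | [::], [::] => true
      end
    end) ->
  forall ts l r, go ts l r ->
  (forall u, u \in l -> exists2 t, height t <= foldr maxn 0 (map height ts) & vl t u) /\
  (forall w, w \in r -> exists2 t, height t <= foldr maxn 0 (map height ts) & vr t w).
Proof.
move=> goE; elim=> [|t ts IH] l r; rewrite goE; first by case/andP => /nilP -> /nilP ->.
rewrite /=; case: l => [|u l]; last first.
  case/andP => v /IH[hl hr]; split=> [u'|w /hr[t' h]].
    rewrite inE => /orP[/eqP ->|/hl[t' h]]; first by exists t => //; rewrite leq_maxl.
    by exists t' => //; rewrite leq_max h orbT.
  by exists t' => //; rewrite leq_max h orbT.
case: r => [|w r] //; case/andP => v /IH[_ hr]; split=> // w'.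
rewrite inE => /orP[/eqP ->|/hr[t' h]]; first by exists t => //; rewrite leq_maxl.
by exists t' => //; rewrite leq_max h orbT.
Qed.

(** Induction on the height. The common neighbours of the known vertices are too many for the covers
    in [C], so one avoids them all; its type is a candidate, and the child for it continues. As the
    height is at least 1, at most [D] vertices per side are known, and [D * d] absorbs their
    non-neighbours. *)
Lemma valid_sound t k nm xs ys us ws : valid t k us ws -> named k nm ->
  height t + size xs <= D.+1 -> height t + size ys <= D.+1 ->
  {subset xs <= SA} -> {subset ys <= SB} ->
  (forall u, u \in us -> exists2 x, x \in xs & has_type SA la Ta k nm x u) ->
  (forall w, w \in ws -> exists2 y, y \in ys & has_type SB lb Tb k nm y w) ->
  False.
Proof.
move: {2}(height t).+1 (ltnSn (height t)) => h.
elim: h t k nm xs ys us ws => // h IH [s C ts] k nm xs ys us ws.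
move=> lth /=; rewrite -/height => /andP[/andP[szC Cok]].
set l := if s is RightSide then _ else _.
set r := if s is LeftSide then _ else _.
move=> /(valid_step (vl := fun t' u => valid t' (bump_names k u) (u :: us) ws)
  (vr := fun t' w => valid t' (bump_names k w) us (w :: ws))) step.
have {step}[|vl vr] := step; first by case.
move=> nmP hxs hys sxs sys hus hws.
pose SA' := [set x in SA | all (E x) ys].
pose SB' := [set y in SB | all (E^~ y) xs].
have cA : #|SA| <= #|SA'| + size ys * d.
  by apply: common_nbrs => y /sys; exact: missB.
have cB : #|SB| <= #|SB'| + size xs * d.
  by apply: (common_nbrs (F := fun y x => E x y)) => x /sxs; exact: missA.
have n0 : 0 < n by have := cover_small (nm 0 0) (isT : 0 < 3); lia.
have hA : 3 * n <= #|SA'|.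
  have : size ys * d <= D * d.
    by rewrite leq_mul2r; apply/orP; right; move: hys => /=; lia.
  lia.
have hB : 3 * n <= #|SB'|.
  have : size xs * d <= D * d.
    by rewrite leq_mul2r; apply/orP; right; move: hxs => /=; lia.
  lia.
have stepA : s <> RightSide -> ~~ [forall x in SA', hits la Ta nm C x] -> False.
  move=> nR; rewrite negb_forall_in => /existsP[x /andP[]].
  rewrite inE => /andP[xSA /allP xys] noth.
  pose u := avoiding C (label_indices la k nm x).
  have uin : u \in l.
    have : u \in avoiders C k ws.
      apply: mem_avoiders => w /hws[y yys tw].
      have nmP' := named_extend Cok nmP xSA noth.
      apply: (type_compat nmP' (xys _ yys) (has_type_new Cok xSA noth)).
      exact: has_type_extend.
    by rewrite /l; case: (s) nR.
  have [t' tin v] := vl _ uin.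
  apply: (IH _ _ _ (x :: xs) ys _ _ _ v (named_extend Cok nmP xSA noth)).
  - by move: tin lth hxs hys => /=; lia.
  - by move: tin lth hxs hys => /=; lia.
  - by move: tin lth hxs hys => /=; lia.
  - by move=> z; rewrite inE => /orP[/eqP -> //|/sxs].
  - exact: sys.
  - move=> u'; rewrite inE => /orP[/eqP ->|/hus[z zxs tz]].
      by exists x; rewrite ?mem_head //; exact: has_type_new.
    by exists z; [rewrite inE zxs orbT|exact: has_type_extend].
  - by move=> w /hws[y yys tw]; exists y => //; exact: has_type_extend.
have stepB : s <> LeftSide -> ~~ [forall y in SB', hits lb Tb nm C y] -> False.
  move=> nL; rewrite negb_forall_in => /existsP[y /andP[]].
  rewrite inE => /andP[ySB /allP yxs] noth.
  pose w := avoiding C (label_indices lb k nm y).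
  have win : w \in r.
    have : w \in avoiders C k us.
      apply: mem_avoiders => u /hus[x xxs tu].
      rewrite tcompatC.
      have nmP' := named_extend Cok nmP ySB noth.
      apply: (type_compat nmP' (yxs _ xxs) _ (has_type_new Cok ySB noth)).
      exact: has_type_extend.
    by rewrite /r; case: (s) nL.
  have [t' tin v] := vr _ win.
  apply: (IH _ _ _ xs (y :: ys) _ _ _ v (named_extend Cok nmP ySB noth)).
  - by move: tin lth hxs hys => /=; lia.
  - by move: tin lth hxs hys => /=; lia.
  - by move: tin lth hxs hys => /=; lia.
  - exact: sxs.
  - by move=> z; rewrite inE => /orP[/eqP -> //|/sys].
  - by move=> u /hus[x xxs tu]; exists x => //; exact: has_type_extend.
  - move=> w'; rewrite inE => /orP[/eqP ->|/hws[z zys tz]].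
      by exists y; rewrite ?mem_head //; exact: has_type_new.
    by exists z; [rewrite inE zys orbT|exact: has_type_extend].
have bound := sum_cover_small nm (C := C).
have {}bound := bound _; rewrite (sub_all _ Cok) in bound; last by move=> ? /andP[].
have {}bound := bound isT.
have szn : size C * n.-1 <= (if s is BothSides then 6 else 3) * n.-1.
  by rewrite leq_mul2r szC orbT.
have bA : [forall x in SA', hits la Ta nm C x] ->
    #|SA'| <= \sum_(s <- C) #|covered SA la Ta s.1 (nm s.1 s.2)|.
  move=> /forall_inP hh; apply: card_hits => //.
  by apply/subsetP => x; rewrite inE => /andP[].
have bB : [forall x in SB', hits lb Tb nm C x] ->
    #|SB'| <= \sum_(s <- C) #|covered SB lb Tb s.1 (nm s.1 s.2)|.
  move=> /forall_inP hh; apply: card_hits => //.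
  by apply/subsetP => x; rewrite inE => /andP[].
(* Otherwise the covers would contain [3 * n] vertices of one side, or [6 * n] of both, but they
   have at most [3 * n.-1] or [6 * n.-1]. *)
case: (boolP [forall x in SA', hits la Ta nm C x]) stepA bA => hitA stepA bA;
case: (boolP [forall y in SB', hits lb Tb nm C y]) stepB bB => hitB stepB bB;
case: (s) szn stepA stepB => szn stepA stepB;
  do ?[exact: stepA | exact: stepB];
  try have := bA isT; try have := bB isT; lia.
Qed.
End Core.

(* Found by computer search. It refutes two vertices on the left which are covered
   in colour 0 only and whose components differ in every colour. *)
Definition two_single_cert : certificate :=
  let L := Cert LeftSide in let R := Cert RightSide in let LR := Cert BothSides in
  let r0 := (0, 0) in let r1 := (0, 1) in let r2 := (0, 2) in
  let b0 := (1, 0) in let b1 := (1, 1) in let b2 := (1, 2) in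
  let g0 := (2, 0) in let g1 := (2, 1) in let g2 := (2, 2) in
LR [::r1;r0;b1;b0;g1;g0] [::R [::r0;b0;g0] [::]; R [::g1;r0;b0] [::]; R
[::r0;b1;b0] [::]; R [::b1;r0;g0] [::]; R [::b1;b0;g1] [::]; R [::r0;b1;b0]
[::]; R [::r0;g1;g0] [::]; R [::r0;g1;g0] [::]; R [::b1;b0;g0] [::R
[::g1;g0;b1] [::R [::g1;b1;b0] [::LR [::r1;r0;g1;g0;b0;b2] [::R [::r0;b0;g0]
[::]; R [::r0;b0;b2] [::LR [::r1;r0;g2;b1;b0;b2] [::R [::r0;g2;b2] [::]; R
[::r1;g1;b1] [::]]]; R [::r1;g1;b0] [::]; R [::r1;b1;g1] [::]; R [::r1;g1;g0]
[::]; R [::r1;r0;g1] [::]; LR [::r1;r0;g1;b1;b0;b2] [::LR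
[::r1;r0;g2;b1;b0;b2] [::R [::r0;g2;b2] [::]; R [::r1;g1;b1] [::]]; R
[::r1;g1;b1] [::]; L [::r1;r0;b2] [::]]]]]; R [::g1;b1;b0] [::R [::g1;g0;b1]
[::LR [::r1;r0;g1;b1;b0;b2] [::R [::r0;g0;b0] [::]; LR [::r1;r0;g2;b1;b0;b2]
[::R [::r0;g0;b0] [::]; R [::r0;g2;b2] [::]; R [::r0;b0;b2] [::]; R
[::r1;g1;b1] [::]; R [::r1;r0;b2] [::]; R [::r1;r0;g1] [::]]; R [::r1;g1;b0]
[::]; R [::r1;g1;b1] [::]; R [::r1;g1;g0] [::]; R [::r1;r0;g1] [::]; LR
[::r1;r0;g0;b1;b0;b2] [::R [::r0;g0;b0] [::]; L [::b2;r1;r0] [::]]]]]; R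
[::g1;g0;b1] [::R [::g1;b1;b0] [::LR [::r1;r0;g1;g0;g2;b2] [::R [::r0;b0;g0]
[::]; R [::r0;b2;g2] [::]; R [::r1;g1;b0] [::]; R [::r1;b1;g1] [::]; R
[::r1;g0;g1] [::]; R [::r1;g1;g0] [::]; R [::r1;b2;g2] [::]; R [::r1;r0;b2]
[::]; R [::r1;r0;g1] [::]; R [::r1;g2;b2] [::]; R [::b1;r1;g1] [::L
[::g2;r0;r1] [::]; L [::r1;r0;g2] [::]]; LR [::r1;r0;b0;g1;g0;g2] [::R
[::r0;b0;g0] [::]; R [::r1;g1;b0] [::]; L [::g2;r1;r0] [::]]]]]; R
[::g1;g0;b1] [::R [::g1;b1;b0] [::R [::r1;g1;b1] [::LR [::r1;r0;b0;b2;g1;g2]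
[::R [::r0;g0;b0] [::]; R [::r0;g2;b2] [::]; R [::r1;g1;b0] [::]; R
[::r1;r0;g2] [::]; L [::g2;r0;r1] [::]; L [::r1;r0;b2] [::R [::g0;r0;b0]
[::]]]; LR [::r1;r0;g1;g0;g2;b0] [::R [::r0;g0;b0] [::]; LR
[::r1;r0;b2;g1;g0;g2] [::R [::r0;b0;g0] [::]; R [::r0;b2;g2] [::]; R
[::r1;g1;g0] [::]; R [::r1;r0;g0] [::]]; R [::r1;g1;g0] [::]; R [::r1;r0;g0]
[::]; L [::r1;r0;g2] [::]]]]]]; R [::r1;b0;g0] [::]; R [::r1;g1;b0] [::]; R
[::r1;b1;b0] [::]; R [::r1;b1;g0] [::]; R [::r1;b1;g1] [::]; R [::r1;b1;b0]
[::]; R [::r1;g1;g0] [::]; R [::r1;g1;g0] [::]; R [::b1;b0;g1] [::R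
[::g0;b1;b0] [::R [::g1;g0;b0] [::LR [::r1;r0;g0;b1;b0;b2] [::R [::r0;g0;b0]
[::]; R [::b1;r0;g0] [::]; R [::r0;g0;g1] [::]; R [::r1;r0;g0] [::]; R
[::r1;g1;b1] [::]; LR [::r1;r0;g2;b1;b0;b2] [::R [::r0;g0;b0] [::]; R
[::r1;b1;b2] [::]; R [::r1;r0;b2] [::]; R [::r1;r0;g0] [::]; R [::r1;g1;b1]
[::]; R [::r1;g2;b2] [::]]; R [::r1;g1;b1] [::L [::r1;r0;b2] [::LR
[::r1;r0;g1;g0;b0;b2] [::]]; L [::r1;r0;b2] [::]]]]]; R [::b1;b0;g0] [::R
[::b0;g1;g0] [::LR [::r1;r0;b1;b2;g0;g2] [::R [::r0;b0;g0] [::]; R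
[::b1;r0;g0] [::]; R [::r0;g0;g1] [::]; R [::r1;r0;g0] [::]; R [::r1;g1;b1]
[::]; R [::r1;b2;g2] [::]; R [::r1;g1;b1] [::L [::r1;r0;b2] [::]; L
[::r1;r0;b2] [::]]; L [::r1;r0;g2] [::R [::b0;r0;g0] [::]]]]]; R [::g1;g0;b1]
[::R [::b0;g1;g0] [::R [::b1;b0;g0] [::LR [::r1;r0;b1;g1;g0;g2] [::R
[::r0;b0;g0] [::]; R [::r1;b1;g1] [::]; LR [::r1;r0;b2;g1;g0;g2] [::R
[::r0;b0;g0] [::]; R [::r1;b1;g1] [::]; R [::r1;b2;g2] [::]]; L [::r1;r0;g2]
[::R [::b0;r0;g0] [::]]]]]; R [::g1;g0;b0] [::R [::g0;b1;b0] [::LR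
[::r1;r0;g1;g2;b0;b2] [::R [::r0;g0;b0] [::]; R [::r1;b1;g1] [::]; R
[::r1;g2;b2] [::]; L [::r1;r0;g2] [::R [::r1;b1;g1] [::]]; L [::r1;r0;b2] [::R
[::g0;r0;b0] [::]]]]]; R [::g1;g0;b0] [::R [::g0;b1;b0] [::LR
[::r1;r0;g1;g0;g2;b2] [::R [::r0;b0;g0] [::]; R [::r0;b2;g2] [::]; R
[::r1;b1;g1] [::]; R [::r1;b2;g2] [::]; R [::r1;g2;b2] [::]; R [::r1;b1;g1]
[::L [::g2;r0;r1] [::]; L [::r1;r0;g2] [::]]; R [::b0;r0;g0] [::L [::g2;r1;r0]
[::]; L [::r1;r0;g2] [::]]]]]; R [::g1;g0;b0] [::R [::g0;b1;b0] [::L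
[::r1;r0;b2] [::R [::r0;g0;b0] [::]; R [::r1;r0;b2] [::]; R [::r1;g1;b1] [::];
L [::r1;r0;g2] [::R [::r0;g0;b0] [::]; R [::r1;r0;b2] [::]; R [::r1;g1;b1]
[::]; R [::r1;g2;b2] [::]]]]]]; R [::g1;g0;b1] [::R [::b1;b0;g0] [::R
[::b0;g1;g0] [::LR [::r1;r0;b1;b0;b2;g0] [::R [::r0;b0;g0] [::]; R
[::r1;g1;b1] [::]; L [::r1;r0;g2] [::R [::r0;g0;b0] [::]; R [::r1;b1;b2] [::];
R [::r1;r0;b2] [::]; R [::r1;r0;g0] [::]; R [::r1;r0;g0] [::]; R [::r1;g1;b1]
[::]; R [::r1;g2;b2] [::]]; R [::r1;g1;b1] [::L [::r1;r0;b2] [::]; L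
[::r1;r0;b2] [::]]]]]; R [::g1;g0;b0] [::R [::g0;b1;b0] [::L [::r1;r0;g2] [::R
[::r0;g0;b0] [::]; R [::r1;r0;g1] [::]; R [::r1;g1;b1] [::]; LR
[::r1;r0;b2;g1;g0;g2] [::R [::r0;b0;g0] [::]; R [::r1;b1;g1] [::]; R
[::r1;g2;b2] [::]]]]]; R [::g1;g0;b0] [::R [::g0;b1;b0] [::L [::r1;r0;g2] [::R
[::r0;g0;b0] [::]; R [::r1;r0;g2] [::]; R [::r1;g1;b1] [::]; L [::r1;r0;b2]
[::R [::r0;b0;g0] [::]; R [::r1;r0;g2] [::]; R [::r1;b1;g1] [::]; R
[::r1;b2;g2] [::]]]]]; R [::g1;g0;b0] [::R [::g0;b1;b0] [::L [::r1;r0;b2] [::R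
[::r0;g0;b0] [::]; R [::r1;r0;g1] [::]; R [::r1;g1;b1] [::]; L [::r1;r0;g2]
[::R [::r0;g0;b0] [::]; R [::r1;r0;g1] [::]; R [::r1;g1;b1] [::]; R
[::r1;g2;b2] [::]]]]]]]; R [::r1;b0;g0] [::]; R [::g1;g0;b0] [::]; R
[::r1;b1;b0] [::]; R [::b1;b0;g0] [::]; R [::r1;b1;g1] [::]; R [::r1;b1;b0]
[::]; R [::r1;g1;g0] [::]; R [::r1;g1;g0] [::]; R [::b1;b0;g0] [::R
[::g1;g0;b1] [::R [::g1;b1;b0] [::R [::g1;g0;b0] [::LR [::r1;r0;g2;b1;b0;b2]
[::R [::r0;g0;b0] [::]; R [::r0;b2;g2] [::]; R [::r1;g1;b1] [::]; R
[::r1;b2;g2] [::]; R [::g1;g0;g2] [::]; R [::r1;g2;b2] [::]; L [::r1;r0;b2]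
[::R [::r1;g1;b1] [::]]; L [::b2;r1;r0] [::R [::g0;b0;r0] [::]]]]]]]].

(* The term 9 * d makes room for removing the non-neighbours of the at most 9
   vertices per side that a certificate of height 8 selects. *)
Record cover_system (A B : finType) (I : eqType) (SA : {set A}) (SB : {set B})
    (la : nat -> A -> I) (lb : nat -> B -> I) (Ta : nat -> pred A)
    (Tb : nat -> pred B) (E : A -> B -> bool) (n d : nat) : Prop := CoverSystem {
  cs_pos : 0 < n;
  cs_compat : forall x y, x \in SA -> y \in SB -> E x y ->
    exists c, [/\ c < 3, la c x = lb c y & Ta c x || Tb c y];
  cs_small : forall c i, c < 3 ->
    #|covered SA la Ta c i| + #|covered SB lb Tb c i| < n;
  cs_missl : forall x, x \in SA -> #|[set y in SB | ~~ E x y]| <= d;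
  cs_missr : forall y, y \in SB -> #|[set x in SA | ~~ E x y]| <= d;
  cs_sizel : 3 * n + 9 * d <= #|SA|;
  cs_sizer : 3 * n + 9 * d <= #|SB| }.

Lemma cover_system_sym (A B : finType) (I : eqType) SA SB la lb Ta Tb E n d :
  @cover_system A B I SA SB la lb Ta Tb E n d ->
  cover_system SB SA lb la Tb Ta (fun y x => E x y) n d.
Proof.
case=> h0 h1 h2 h3 h4 h5 h6; split=> // [y x ySB xSA Exy|c i c3].
  by have [c [c3 e T]] := h1 x y xSA ySB Exy; exists c; rewrite e orbC.
by rewrite addnC; exact: h2.
Qed.

Definition rot3 c0 c := (c0 + c) %% 3.

Lemma cover_system_rot (A B : finType) (I : eqType) SA SB la lb Ta Tb E n d c0 :
  @cover_system A B I SA SB la lb Ta Tb E n d ->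
  cover_system SA SB (la \o rot3 c0) (lb \o rot3 c0) (Ta \o rot3 c0)
    (Tb \o rot3 c0) E n d.
Proof.
case=> h0 h1 h2 h3 h4 h5 h6; split=> // [x y xSA ySB Exy|c i c3]; last first.
  by apply: h2; rewrite /rot3 ltn_mod.
have [c [c3 e T]] := h1 x y xSA ySB Exy.
(* This inverts the rotation: [c0 + (2 * c0 + c)] is [c] modulo 3. *)
exists ((2 * c0 + c) %% 3); rewrite ltn_mod.
have -> : (la \o rot3 c0) ((2 * c0 + c) %% 3) = la c.
  by rewrite /= /rot3; congr (la _); lia.
have -> : (lb \o rot3 c0) ((2 * c0 + c) %% 3) = lb c.
  by rewrite /= /rot3; congr (lb _); lia.
by rewrite /= /rot3 (_ : (c0 + _) %% 3 = c) //; lia.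
Qed.

(** * Vertices covered in no colour, or in a single colour *)

Section CoverSystem.
Variables (A B : finType) (I : eqType) (SA : {set A}) (SB : {set B}).
Variables (la : nat -> A -> I) (lb : nat -> B -> I).
Variables (Ta : nat -> pred A) (Tb : nat -> pred B) (E : A -> B -> bool).
Variables (n d : nat).
Hypothesis cs : cover_system SA SB la lb Ta Tb E n d.

(** The case [D = 9], which explains the bound 10, with known vertices on the left only. *)
Lemma cover_system_valid t k nm xs us : valid t k us [::] -> named k nm ->
  height t + size xs <= 10 -> {subset xs <= SA} ->
  (forall u, u \in us -> exists2 x, x \in xs & has_type SA la Ta k nm x u) ->
  False.
Proof.
case: cs => _ h1 h2 h3 h4 h5 h6 v nmP hxs sxs hus.
apply: (valid_sound h1 h2 h3 h4 h5 h6 v nmP hxs (ys := [::])) => //.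
by rewrite addn0; apply: leq_trans hxs; rewrite leq_addr.
Qed.

Lemma cover_nonempty x : x \in SA -> has (fun c => Ta c x) (iota 0 3).
Proof.
move=> xSA; apply/negP => /negP/hasPn noT.
(* Every neighbour of an uncovered [x] lies in the cover of one of the three components of [x];
   outside these covers no type remains, so the certificate has no children. *)
apply: (@cover_system_valid (Cert RightSide [:: (0, 0); (1, 0); (2, 0)] [::])
  [:: 1; 1; 1] (fun c _ => la c x) [:: x]
  [:: ([:: 0; 0; 0], [:: false; false; false])]).
- by [].
- by case=> [|[|[|]]] // [|i] [|j].
- by [].
- by move=> z; rewrite inE => /eqP ->.
move=> u; rewrite inE => /eqP ->; exists x; first exact: mem_head.
split=> // c c3; split; first by case: c c3 => [|[|[|]]].
  by [].
by move=> Tc; have := noT c; rewrite mem_iota c3 Tc => /(_ isT).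
Qed.

Lemma single_colour0 x1 x2 : x1 \in SA -> x2 \in SA ->
  ~~ Ta 1 x1 -> ~~ Ta 2 x1 -> ~~ Ta 1 x2 -> ~~ Ta 2 x2 -> la 0 x1 = la 0 x2.
Proof.
move=> x1S x2S n11 n12 n21 n22; apply/eqP; apply/negP => /negP ne.
have [[b bE] [g gE]] : (exists b : bool, b = (la 1 x1 != la 1 x2) :> bool) /\
    exists g : bool, g = (la 2 x1 != la 2 x2) :> bool by split; eexists.
(* If [x1] and [x2] share their component in colour 1 or in colour 2, three covers suffice: a common
   neighbour outside them could only be joined to both in colour 0, where their components
   differ. *)
pose t := if ~~ b then Cert RightSide [:: (1, 0); (2, 0); (2, g : nat)] [::]
  else if ~~ g then Cert RightSide [:: (2, 0); (1, 0); (1, 1)] [::]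
  else two_single_cert.
pose nm (c i : nat) := if i == 0 then la c x1 else la c x2.
apply: (@cover_system_valid t [:: 2; b.+1; g.+1] nm [:: x2; x1]
  [:: ([:: 1; b : nat; g : nat], [:: true; false; false]);
      ([:: 0; 0; 0], [:: true; false; false])]).
- by rewrite /t; case: (b); case: (g); vm_compute.
- case=> [|[|[|]]] // [|i] [|j] //=; rewrite ?ltnS ?ltn0 // /nm /=.
  + by move=> _ _ _ /eqP; rewrite (negbTE ne).
  + by move=> _ _ _ /esym/eqP; rewrite (negbTE ne).
  + by move: i j => [|i] [|j].
  + by case: (b) bE => [/esym/eqP nb|] //= _ _ _ /nb.
  + by case: (b) bE => [/esym/eqP nb|] //= _ _ _ /esym/nb.
  + by case: (b); move: i j => [|i] [|j].
  + by case: (g) gE => [/esym/eqP nb|] //= _ _ _ /nb.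
  + by case: (g) gE => [/esym/eqP nb|] //= _ _ _ /esym/nb.
  + by case: (g); move: i j => [|i] [|j].
(* Height at most 8, and two known vertices. *)
- rewrite -[10]/(8 + 2) leq_add2r.
  by rewrite /t; case: (b); case: (g); vm_compute.
- by move=> z; rewrite !inE => /orP[/eqP ->|/eqP ->].
move=> u; rewrite !inE => /orP[/eqP ->|/eqP ->]; [exists x2|exists x1];
  rewrite ?inE ?eqxx ?orbT //; split=> // c c3.
- have e1 : la 1 x2 = nm 1 b.
    by rewrite /nm; case: (b) bE => //= /esym/negbFE/eqP ->.
  have e2 : la 2 x2 = nm 2 g.
    by rewrite /nm; case: (g) gE => //= /esym/negbFE/eqP ->.
  by case: c c3 => [|[|[|]]] //= _; split; rewrite ?(negbTE n21) ?(negbTE n22).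
- by case: c c3 => [|[|[|]]] //= _; split; rewrite ?(negbTE n11) ?(negbTE n12).
Qed.
End CoverSystem.

Lemma single_colour (A B : finType) (I : eqType) SA SB la lb Ta Tb E n d c0 x1 x2 :
  @cover_system A B I SA SB la lb Ta Tb E n d -> c0 < 3 ->
  x1 \in SA -> x2 \in SA ->
  (forall c, c < 3 -> Ta c x1 -> c = c0) -> (forall c, c < 3 -> Ta c x2 -> c = c0) ->
  la c0 x1 = la c0 x2.
Proof.
move=> cs c03 x1S x2S s1 s2.
have noT i x : (forall c, c < 3 -> Ta c x -> c = c0) -> 0 < i < 3 ->
    ~~ (Ta \o rot3 c0) i x.
  move=> s i3; apply/negP => /= /s; rewrite /rot3 ltn_mod => /(_ isT); lia.
have := single_colour0 (cover_system_rot c0 cs) x1S x2S (noT 1 _ s1 isT)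
  (noT 2 _ s1 isT) (noT 1 _ s2 isT) (noT 2 _ s2 isT).
by rewrite /= /rot3 addn0 modn_small.
Qed.

(** * Counting covered vertices *)

Definition single (X : finType) (SX : {set X}) (Tx : nat -> pred X) c :=
  [set x in SX | Tx c x && all (fun c' => Tx c' x ==> (c' == c)) (iota 0 3)].

Lemma single_sub (A B : finType) (I : eqType) SA SB la lb Ta Tb E n d c x :
  @cover_system A B I SA SB la lb Ta Tb E n d -> c < 3 ->
  x \in single SA Ta c -> single SA Ta c \subset covered SA la Ta c (la c x).
Proof.
move=> cs c3; have only z : z \in single SA Ta c ->
    forall c', c' < 3 -> Ta c' z -> c' = c.
  rewrite inE => /and3P[_ _ /allP h] c' c'3 T; apply/eqP.
  by have := h c'; rewrite mem_iota c'3 T; apply.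
move=> xs; apply/subsetP => z zs.
have mem t : t \in single SA Ta c -> t \in SA /\ Ta c t by rewrite inE => /and3P[].
have [zS Tz] := mem z zs; have [xS _] := mem x xs.
by rewrite inE zS Tz (single_colour cs c3 zS xS (only z zs) (only x xs)) eqxx.
Qed.

(** Each of the two sets lies in the cover of one component. If these components agree, [cs_small]
    bounds both sets together. Otherwise a vertex [x] of the left set has no edge to the right set,
    as such an edge would have colour [c] and join different components; so the right set has at
    most [d] vertices. *)
Lemma card_single (A B : finType) (I : eqType) SA SB la lb Ta Tb E n d c :
  @cover_system A B I SA SB la lb Ta Tb E n d -> c < 3 ->
  #|single SA Ta c| + #|single SB Tb c| < n + d.
Proof.
move=> cs c3; have cs' := cover_system_sym cs.
have small i := cs_small cs i c3.
case: (set_0Vmem (single SA Ta c)) => [->|[x xs]].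
  rewrite cards0; case: (set_0Vmem (single SB Tb c)) => [->|[y ys]].
    by rewrite cards0; have := cs_pos cs; lia.
  have := subset_leq_card (single_sub cs' c3 ys); have := small (lb c y); lia.
have sA := subset_leq_card (single_sub cs c3 xs).
case: (set_0Vmem (single SB Tb c)) => [->|[y ys]].
  by rewrite cards0; have := small (la c x); lia.
have sB := subset_leq_card (single_sub cs' c3 ys).
case: (eqVneq (la c x) (lb c y)) => [e|ne].
  by have := small (la c x); move: sA sB; rewrite e; lia.
suff : #|single SB Tb c| <= d by have := small (la c x); lia.
move: xs; rewrite inE => /and3P[xS Tx /allP ox].
apply: leq_trans (cs_missl cs xS); apply: subset_leq_card.
apply/subsetP => z zs; have := subsetP (single_sub cs' c3 ys) z zs.
move: zs; rewrite !inE => /and3P[zS Tz /allP oz] /and3P[_ /eqP ez _].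
rewrite zS /=; apply/negP => Exz.
have [c' [c'3 e T]] := cs_compat cs xS zS Exz.
have ec : c' = c.
  have := ox c'; have := oz c'; rewrite mem_iota c'3 => /(_ isT) + /(_ isT).
  by case/orP: T => -> /=; [move=> _ /eqP|move=> /eqP].
by move/eqP: ne; apply; rewrite -ez -ec.
Qed.

(* Every vertex is covered, and fewer than 3 (n + d) vertices are covered in a
   single colour; so the covers contain, with multiplicity, more vertices than
   three times the smaller side. *)
Lemma cover_system_false (A B : finType) (I : eqType) SA SB la lb Ta Tb E n d :
  @cover_system A B I SA SB la lb Ta Tb E n d ->
  (forall c, c < 3 -> #|[set x in SA | Ta c x]| + #|[set y in SB | Tb c y]| <= #|SA|) ->
  (forall c, c < 3 -> #|[set x in SA | Ta c x]| + #|[set y in SB | Tb c y]| <= #|SB|) ->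
  False.
Proof.
move=> cs tA tB; have cs' := cover_system_sym cs.
(* Every vertex contributes at least 2 on the right: it is covered twice, or covered once and
   counted again as single. *)
have count (X : finType) (SX : {set X}) (Tx : nat -> pred X) :
    (forall x, x \in SX -> has (fun c => Tx c x) (iota 0 3)) ->
    2 * #|SX| <= \sum_(0 <= c < 3) #|[set x in SX | Tx c x]| +
      \sum_(0 <= c < 3) #|single SX Tx c|.
  move=> cov; rewrite mulnC -sum_nat_const.
  have cardE (P : pred X) : #|[set x in SX | P x]| = \sum_(x in SX) P x.
    rewrite -sum1_card big_mkcond [RHS]big_mkcond; apply: eq_bigr => x _.
    by rewrite inE; case: (x \in SX); case: (P x).
  rewrite (eq_bigr _ (fun c _ => cardE (Tx c))).
  rewrite [X in _ <= _ + X](eq_bigr _ (fun c _ => cardE (fun x => Tx c x &&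
    all (fun c' => Tx c' x ==> (c' == c)) (iota 0 3)))).
  rewrite exchange_big /= [X in _ <= _ + X]exchange_big /= -big_split /=.
  apply: leq_sum => x /cov; rewrite !big_nat_recr ?big_geq //= !add0n.
  by case: (Tx 0 x); case: (Tx 1 x); case: (Tx 2 x).
have := count _ _ _ (cover_nonempty cs); have := count _ _ _ (cover_nonempty cs').
rewrite !big_nat_recr ?big_geq //= !add0n.
have := card_single cs (isT : 0 < 3); have := card_single cs (isT : 1 < 3).
have := card_single cs (isT : 2 < 3).
have := tA 0 isT; have := tA 1 isT; have := tA 2 isT.
have := tB 0 isT; have := tB 1 isT; have := tB 2 isT.
have := cs_sizel cs; have := cs_sizer cs.
(* If [a] is the size of the smaller side, then [4 * a < 3 * a + 3 * (n + d)], against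
   [a >= 3 * n + 9 * d]. *)
lia.
Qed.

(** * Connected matchings *)

(** The cover from Koenig's theorem competes with the trivial covers [PA] and [PB]; the smallest of
    the three meets all the bounds. *)
Lemma small_cover (A B : finType) (F : {set A * B}) (PA : {set A}) (PB : {set B}) n :
  (forall p, p \in F -> (p.1 \in PA) && (p.2 \in PB)) ->
  ~ (exists M : {set A * B}, [/\ M \subset F, matching M & n <= #|M|]) ->
  exists PQ : {set A} * {set B}, [/\ edge_cover F PQ.1 PQ.2,
    #|PQ.1| + #|PQ.2| < n, #|PQ.1| + #|PQ.2| <= #|PA| & #|PQ.1| + #|PQ.2| <= #|PB|].
Proof.
move=> sub noM.
have [P [Q [cov lt]]] : exists P Q, edge_cover F P Q /\ #|P| + #|Q| < n.
  apply: contrapT => nex; apply: noM; apply: koenig => P Q cov.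
  by rewrite leqNgt; apply/negP => lt; apply: nex; exists P, Q.
pose m := minn (#|P| + #|Q|) (minn #|PA| #|PB|).
suff [PQ [c e]] : exists PQ : {set A} * {set B}, edge_cover F PQ.1 PQ.2 /\
    #|PQ.1| + #|PQ.2| = m by exists PQ; rewrite e; split=> //; rewrite /m; lia.
have [e|[e|e]] : m = #|P| + #|Q| \/ m = #|PA| \/ m = #|PB| by rewrite /m; lia.
- by exists (P, Q).
- exists (PA, set0); rewrite /= cards0 addn0 e; split=> // p /sub.
  by case/andP => ->.
exists (set0, PB); rewrite /= cards0 add0n e; split=> // p /sub.
by case/andP => _ ->; rewrite orbT.
Qed.

(** Without such a matching, [small_cover] applies to every component of every colour, and the
    covers form a cover system, which [cover_system_false] excludes. The components of one colour
    partition each side, so their covers together are at most as large as either side. *)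
Lemma connected_matching (A B I : finType) (SA : {set A}) (SB : {set B})
    (la : nat -> A -> I) (lb : nat -> B -> I) (col : A -> B -> nat)
    (E : A -> B -> bool) (n d : nat) :
  0 < n ->
  (forall x y, x \in SA -> y \in SB -> E x y ->
    col x y < 3 /\ la (col x y) x = lb (col x y) y) ->
  (forall x, x \in SA -> #|[set y in SB | ~~ E x y]| <= d) ->
  (forall y, y \in SB -> #|[set x in SA | ~~ E x y]| <= d) ->
  3 * n + 9 * d <= #|SA| -> 3 * n + 9 * d <= #|SB| ->
  exists c i, exists M : {set A * B}, [/\ matching M, n <= #|M| &
    forall p, p \in M -> [/\ p.1 \in SA, p.2 \in SB, E p.1 p.2,
      col p.1 p.2 = c & la c p.1 = i]].
Proof.
move=> n0 colP mA mB sA sB; apply: contrapT => noM.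
pose F c i : {set A * B} := [set p | [&& p.1 \in SA, p.2 \in SB, E p.1 p.2,
  col p.1 p.2 == c & la c p.1 == i]].
pose PA c i := [set x in SA | la c x == i].
pose PB c i := [set y in SB | lb c y == i].
have cov (ci : nat * I) : exists PQ : {set A} * {set B},
    [/\ edge_cover (F ci.1 ci.2) PQ.1 PQ.2, #|PQ.1| + #|PQ.2| < n,
     #|PQ.1| + #|PQ.2| <= #|PA ci.1 ci.2| & #|PQ.1| + #|PQ.2| <= #|PB ci.1 ci.2|].
  case: ci => c i /=; apply: small_cover => [p|[M [sM mM nM]]].
    rewrite !inE => /and5P[pA pB Ep /eqP pc /eqP pi]; rewrite pA pB /= pi eqxx /=.
    by have [_ e] := colP _ _ pA pB Ep; rewrite -pi -pc e.
  apply: noM; exists c, i, M; split=> // p /(subsetP sM).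
  by rewrite inE => /and5P[pA pB Ep /eqP pc /eqP pi].
have {cov}[PQ PQP] := choice cov.
pose Ta c x := x \in (PQ (c, la c x)).1.
pose Tb c y := y \in (PQ (c, lb c y)).2.
have sub1 c i : #|covered SA la Ta c i| <= #|(PQ (c, i)).1|.
  apply: subset_leq_card; apply/subsetP => x; rewrite inE.
  by case/and3P => _ /eqP <-.
have sub2 c i : #|covered SB lb Tb c i| <= #|(PQ (c, i)).2|.
  apply: subset_leq_card; apply/subsetP => x; rewrite inE.
  by case/and3P => _ /eqP <-.
have split_card (X : finType) (SX : {set X}) (lx : X -> I) :
    #|SX| = \sum_i #|[set x in SX | lx x == i]|.
  rewrite -sum1_card (partition_big lx predT) //=; apply: eq_bigr => i _.
  by rewrite sum1dep_card.
have tot c : #|[set x in SA | Ta c x]| + #|[set y in SB | Tb c y]| <=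
    \sum_i (#|(PQ (c, i)).1| + #|(PQ (c, i)).2|).
  rewrite big_split /=; apply: leq_add.
    rewrite (split_card _ [set x in SA | Ta c x] (la c)); apply: leq_sum => i _.
    apply: leq_trans (sub1 c i); apply: subset_leq_card; apply/subsetP => x.
    by rewrite !inE -andbA (andbC (Ta c x)).
  rewrite (split_card _ [set y in SB | Tb c y] (lb c)); apply: leq_sum => i _.
  apply: leq_trans (sub2 c i); apply: subset_leq_card; apply/subsetP => x.
  by rewrite !inE -andbA (andbC (Tb c x)).
apply: (@cover_system_false A B I SA SB la lb Ta Tb E n d).
- split=> // [x y xS yS Exy|c i _].
    have [c3 e] := colP x y xS yS Exy; exists (col x y); split=> //.
    have [cov _ _ _] := PQP (col x y, la (col x y) x).
    have := cov (x, y); rewrite !inE /= xS yS Exy !eqxx => /(_ isT).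
    by rewrite /Ta /Tb -e.
  have [_ lt _ _] := PQP (c, i); have := sub1 c i; have := sub2 c i.
  by move: lt => /=; lia.
- move=> c _; apply: leq_trans (tot c) _; rewrite (split_card _ SA (la c)).
  by apply: leq_sum => i _; have [] := PQP (c, i).
- move=> c _; apply: leq_trans (tot c) _; rewrite (split_card _ SB (lb c)).
  by apply: leq_sum => i _; have [] := PQP (c, i).
Qed.

(** * Regularity *)

Import Order.TTheory GRing.Theory Num.Theory.

Section Energy.
Local Open Scope ring_scope.
Variables (Z : finType) (u : Z -> rat).

Definition block_mean (T : finType) (h : Z -> T) (t : T) : rat :=
  (\sum_(z | h z == t) u z) / #|[set z | h z == t]|%:R.

(** The unnormalised mean-square density of Szemeredi's lemma: the squared norm of the conditional
    expectation of [u] given [h]. *)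
Definition energy (T : finType) (h : Z -> T) : rat :=
  \sum_z block_mean h (h z) ^+ 2.

(** Conditional expectation is the orthogonal projection onto the functions constant on blocks. *)
Lemma sum_block_mean (T : finType) (h : Z -> T) (w : T -> rat) :
  \sum_z block_mean h (h z) * w (h z) = \sum_z u z * w (h z).
Proof.
rewrite (partition_big h predT) //= [RHS](partition_big h predT) //=.
apply: eq_bigr => t _.
rewrite (eq_bigr (fun _ => block_mean h t * w t)); last by move=> z /eqP ->.
rewrite [RHS](eq_bigr (fun z => u z * w t)); last by move=> z /eqP ->.
have -> : \sum_(z | h z == t) (block_mean h t * w t) =
    block_mean h t * w t * #|[set z | h z == t]|%:R.
  rewrite -sum1_card natr_sum mulr_sumr; apply: eq_big => [z|z _].
    by rewrite inE.
  by rewrite mulr1.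
rewrite -mulr_suml /block_mean; case: (posnP #|[set z | h z == t]|) => [e|n0].
  rewrite e mulr0 big_pred0 ?mul0r // => z.
  by move/eqP: e; rewrite cards_eq0 => /eqP/setP/(_ z); rewrite !inE.
by field; rewrite pnatr_eq0 -lt0n.
Qed.

(* The Pythagorean identity, in the form of a lower bound by a test function v
   that is constant on the blocks of the finer partition. *)
Lemma energy_refine (T T' : finType) (h : Z -> T) (h' : Z -> T') (r : T' -> T)
    (v : T' -> rat) : (forall z, h z = r (h' z)) ->
  energy h + \sum_z (2 * v (h' z) * (block_mean h (h z) - u z) - v (h' z) ^+ 2)
    <= energy h'.
Proof.
move=> hr; pose D z := block_mean h (h z); pose D' z := block_mean h' (h' z).
have e1 : \sum_z D' z * D z = \sum_z D z ^+ 2.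
  have := sum_block_mean h' (fun t => block_mean h (r t)).
  have := sum_block_mean h (block_mean h).
  rewrite /D /D'; under [X in _ -> X = _ -> _]eq_bigr do rewrite -hr.
  under [X in _ -> _ = X -> _]eq_bigr do rewrite -hr.
  by move=> <- ->; apply: eq_bigr => z _; rewrite expr2.
have e2 : \sum_z D' z * v (h' z) = \sum_z u z * v (h' z) by exact: sum_block_mean.
rewrite /energy -/D -subr_ge0.
(* Once [e1] and [e2] evaluate the cross terms, the gap in the inequality is a sum of squares. *)
have <- : \sum_z (D' z - D z + v (h' z)) ^+ 2 = \sum_z D' z ^+ 2 - (\sum_z D z ^+ 2 +
    \sum_z (2 * v (h' z) * (D z - u z) - v (h' z) ^+ 2)).
  rewrite -big_split -sumrB /=.
  apply/eqP; rewrite -subr_eq0 -sumrB.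
  rewrite (eq_bigr (fun z => - 2 * (D' z * D z) + (2 * D z ^+ 2 +
     (2 * (D' z * v (h' z)) - 2 * (u z * v (h' z)))))); last by move=> z _; ring.
  rewrite !big_split /= sumrN -!mulr_sumr e1 e2; apply/eqP; ring.
by apply: sumr_ge0 => z _; apply: sqr_ge0.
Qed.

Lemma energy_le (T : finType) (h : Z -> T) : (forall z, 0 <= u z <= 1) ->
  energy h <= #|Z|%:R.
Proof.
move=> u01; rewrite /energy -sum1_card natr_sum; apply: ler_sum => z _.
have m0 : 0 <= block_mean h (h z).
  by apply: divr_ge0 => //; apply: sumr_ge0 => i _; case/andP: (u01 i).
suff m1 : block_mean h (h z) <= 1 by rewrite expr2 -[1]mulr1 ler_pM.
rewrite /block_mean ler_pdivrMr ?mul1r; last first.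
  by rewrite ltr0n; apply/card_gt0P; exists z; rewrite inE.
rewrite -sum1_card natr_sum (eq_bigl (fun y => h y == h z)).
  by apply: ler_sum => y _; case/andP: (u01 y).
by move=> y; rewrite inE.
Qed.
End Energy.

(** One-sided regularity: subsets holding at least a fraction [1 / m] of their clusters span density
    at least [1 / 6], half of what the densest of three colours has. *)
Definition lower_regular (A B L J : finType) (f : A -> L) (g : B -> J)
    (e : A -> B -> bool) (m : nat) (i : L) (j : J) :=
  [forall X : {set A}, forall Y : {set B},
    [&& X \subset f @^-1: [set i], Y \subset g @^-1: [set j],
        #|f @^-1: [set i]| <= m * #|X| & #|g @^-1: [set j]| <= m * #|Y|] ==>
    (#|X| * #|Y| <= 6 * #|[set p in setX X Y | e p.1 p.2]|)].

Definition no_regular_colour (A B L J : finType) (f : A -> L) (g : B -> J)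
    (col : A -> B -> 'I_3) (m : nat) (i : L) (j : J) :=
  [forall c, ~~ lower_regular f g (fun x y => col x y == c) m i j].

Section Regularity.
Local Open Scope ring_scope.
Variables (A B : finType) (col : A -> B -> 'I_3) (m : nat).
Hypothesis m_gt0 : (0 < m)%N.

Definition colour_ind (c : 'I_3) (p : A * B) : rat := (col p.1 p.2 == c)%:R.

Definition pair_label (L J : finType) (f : A -> L) (g : B -> J) (p : A * B) :=
  (f p.1, g p.2).

Definition colour_energy (L J : finType) (f : A -> L) (g : B -> J) :=
  \sum_c energy (colour_ind c) (pair_label f g).

Lemma colour_energy_le (L J : finType) (f : A -> L) (g : B -> J) :
  colour_energy f g <= 3 * (#|A| * #|B|)%:R.
Proof.
apply: le_trans (_ : \sum_(c < 3) (#|A| * #|B|)%:R <= _); last first.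
  by rewrite sumr_const card_ord [leRHS]mulrC mulr_natr.
apply: ler_sum => c _; rewrite -card_prod; apply: energy_le => z.
by rewrite /colour_ind; case: (_ == _).
Qed.

(* In a pair of clusters without a regular colour, the witnesses of irregularity
   for a majority colour have density below 1/6 instead of at least 1/3; the
   test function 1/6 on these witnesses yields the energy increment. *)
Lemma refine_step (L J : finType) (f : A -> L) (g : B -> J) :
  (#|A| * #|B| < m * #|[set p | no_regular_colour f g col m (f p.1) (g p.2)]|)%N ->
  exists (f' : A -> L * {ffun J -> bool}) (g' : B -> J * {ffun L -> bool}),
    colour_energy f g + (#|A| * #|B|)%:R / (36 * m ^ 3)%:R <= colour_energy f' g'.
Proof.
move=> bad_gt.
pose bad := no_regular_colour f g col m.
pose mean c i j := block_mean (colour_ind c) (pair_label f g) (i, j).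
pose Ai i := f @^-1: [set i]; pose Bj j := g @^-1: [set j].
have mean_sum i j x y : f x = i -> g y = j -> \sum_c mean c i j = 1.
  move=> fx gy; rewrite /mean /block_mean -mulr_suml exchange_big /=.
  rewrite (eq_bigr (fun=> 1)) => [|z _]; last first.
    rewrite (bigD1 (col z.1 z.2)) //= big1 ?addr0 /colour_ind ?eqxx // => c.
    by rewrite eq_sym => /negbTE ->.
  have -> : \sum_(z | pair_label f g z == (i, j)) 1 =
      #|[set z | pair_label f g z == (i, j)]|%:R :> rat.
    rewrite -sum1_card natr_sum [RHS]big_mkcond [LHS]big_mkcond /=.
    by apply: eq_bigr => z _; rewrite inE.
  rewrite divff // pnatr_eq0 -lt0n; apply/card_gt0P; exists (x, y).
  by rewrite inE /pair_label /= fx gy.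
have wit (ij : L * J) : exists w : 'I_3 * ({set A} * {set B}), bad ij.1 ij.2 ->
   [/\ w.2.1 \subset Ai ij.1, w.2.2 \subset Bj ij.2,
      (#|Ai ij.1| <= m * #|w.2.1|)%N, (#|Bj ij.2| <= m * #|w.2.2|)%N &
      (6 * #|[set p in setX w.2.1 w.2.2 | col p.1 p.2 == w.1]| < #|w.2.1| * #|w.2.2|)%N
      /\ 1 / 3 <= mean w.1 ij.1 ij.2].
  case: ij => i j /=; have [bij|nbij] := boolP (bad i j); last first.
    by exists (ord0, (set0, set0)).
  have wc c : exists XY : {set A} * {set B}, [/\ XY.1 \subset Ai i, XY.2 \subset Bj j,
      (#|Ai i| <= m * #|XY.1|)%N, (#|Bj j| <= m * #|XY.2|)%N &
      (6 * #|[set p in setX XY.1 XY.2 | col p.1 p.2 == c]| < #|XY.1| * #|XY.2|)%N].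
    move/forallP/(_ c): bij; rewrite /lower_regular negb_forall => /existsP[X].
    rewrite negb_forall => /existsP[Y]; rewrite negb_imply -ltnNge.
    by case/andP => /and4P[? ? ? ?] ?; exists (X, Y).
  have [XY [sX sY _ _ lt]] := wc ord0.
  have [x xX] : exists x, x \in XY.1.
    by apply/set0Pn; rewrite -card_gt0; move: lt; case: #|XY.1|.
  have [y yY] : exists y, y \in XY.2.
    by apply/set0Pn; rewrite -card_gt0; move: lt; case: #|XY.2| => //; rewrite muln0.
  have fx : f x = i by move/subsetP/(_ _ xX): sX; rewrite !inE => /eqP.
  have gy : g y = j by move/subsetP/(_ _ yY): sY; rewrite !inE => /eqP.
  have [c cmean] : exists c, 1 / 3 <= mean c i j.
    apply: contrapT => nex; have := mean_sum i j x y fx gy.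
    suff : \sum_c mean c i j < \sum_(c < 3) 1 / 3 by rewrite sumr_const card_ord; lra.
    apply: ltr_sum => [|c _]; last first.
      by rewrite ltNge; apply/negP => h; apply: nex; exists c.
    by apply/hasP; exists ord0; rewrite ?mem_index_enum.
  by have [XY' [? ? ? ? ?]] := wc c; exists (c, XY').
have {wit}[w wP] := choice wit.
(* Each cluster is cut by its witnesses against all opposite clusters, so every witness rectangle is
   a union of new blocks. *)
pose f' x := (f x, [ffun j => x \in (w (f x, j)).2.1]).
pose g' y := (g y, [ffun i => y \in (w (i, g y)).2.2]).
exists f', g'.
pose inW c (p : A * B) := [&& bad (f p.1) (g p.2), (w (f p.1, g p.2)).1 == c,
   p.1 \in (w (f p.1, g p.2)).2.1 & p.2 \in (w (f p.1, g p.2)).2.2].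
have step c : energy (colour_ind c) (pair_label f g) +
   \sum_z (2 * (1 / 6 * (inW c z)%:R) * (mean c (f z.1) (g z.2) - colour_ind c z)
      - (1 / 6 * (inW c z)%:R) ^+ 2) <= energy (colour_ind c) (pair_label f' g').
  pose v (t : (L * {ffun J -> bool}) * (J * {ffun L -> bool})) : rat :=
    1 / 6 * [&& bad t.1.1 t.2.1, (w (t.1.1, t.2.1)).1 == c, t.1.2 t.2.1 & t.2.2 t.1.1]%:R.
  have := @energy_refine _ (colour_ind c) _ _ (pair_label f g) (pair_label f' g')
    (fun t => (t.1.1, t.2.1)) v (fun=> erefl).
  by under eq_bigr do rewrite /v /= !ffunE.
rewrite /colour_energy.
apply: le_trans (ler_sum _ (fun c _ => step c)); rewrite big_split lerD2l /=.
pose inXY (z : A * B) (ij : L * J) := (z.1 \in (w ij).2.1) && (z.2 \in (w ij).2.2).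
pose F (z : A * B) : rat := if bad (f z.1) (g z.2) && inXY z (f z.1, g z.2) then
  1 / 3 * (mean (w (f z.1, g z.2)).1 (f z.1) (g z.2) -
           colour_ind (w (f z.1, g z.2)).1 z) - 1 / 36 else 0.
have sumF : \sum_c \sum_z (2 * (1 / 6 * (inW c z)%:R) *
    (mean c (f z.1) (g z.2) - colour_ind c z) - (1 / 6 * (inW c z)%:R) ^+ 2) =
    \sum_z F z.
  rewrite exchange_big /=; apply: eq_bigr => z _.
  rewrite (bigD1 (w (f z.1, g z.2)).1) //= big1 ?addr0 => [|c /negbTE ne].
    rewrite /inW /F /inXY eqxx /=; case: (bad _ _) => /=; last by field.
    case: (z.1 \in _) => /=; last by field.
    by case: (z.2 \in _) => /=; field.
  have -> : inW c z = false by rewrite /inW [_ == c]eq_sym ne andbF.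
  by rewrite (_ : false%:R = 0 :> rat) //; ring.
rewrite sumF; pose badset := [set p | bad (f p.1) (g p.2)].
(* More than a fraction [1 / m] of all vertex pairs is bad, so a gain of [1 / (36 * m ^ 2)] on each
   of them suffices. *)
apply: le_trans (_ : \sum_z (bad (f z.1) (g z.2))%:R / (36 * m ^ 2)%:R <= _).
  rewrite -mulr_suml (_ : \sum_z _ = #|badset|%:R); last first.
    rewrite -sum1_card natr_sum [RHS]big_mkcond /=; apply: eq_bigr => z _.
    by rewrite inE; case: (bad _ _).
  rewrite ler_pdivrMr ?ltr0n ?muln_gt0 ?expn_gt0 ?m_gt0 //.
  rewrite mulrAC ler_pdivlMr ?ltr0n ?muln_gt0 ?expn_gt0 ?m_gt0 //.
  have e3 : (36 * m ^ 3 = m * (36 * m ^ 2))%N by rewrite mulnCA -expnS.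
  rewrite -!natrM ler_nat e3 [X in (_ <= X)%N]mulnA.
  by rewrite leq_mul2r [X in (_ <= X)%N]mulnC (ltnW bad_gt) orbT.
rewrite (partition_big (pair_label f g) predT) //=.
rewrite [leRHS](partition_big (pair_label f g) predT) //=.
apply: ler_sum => -[i j] _; rewrite /pair_label.
have toXY (G : A * B -> rat) : \sum_(z | (f z.1, g z.2) == (i, j)) G z =
    \sum_(z in setX (Ai i) (Bj j)) G z.
  by apply: eq_bigl => z; rewrite !inE xpair_eqE.
have [bij|nbij] := boolP (bad i j); last first.
  by rewrite !big1 // => z; rewrite xpair_eqE => /andP[/eqP ei /eqP ej];
    rewrite /F ei ej (negbTE nbij) //= mul0r.
have := wP (i, j) bij; case ew: (w (i, j)) => [c [X Y]] /=.
case=> sX sY lX lY [small big_mean].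
have -> : \sum_(z | (f z.1, g z.2) == (i, j)) F z =
    \sum_(z in setX X Y) (1 / 3 * (mean c i j - colour_ind c z) - 1 / 36).
  rewrite toXY (big_setID (setX X Y)) /= [X in _ + X]big1 ?addr0.
    rewrite (setIidPr _); last by apply: setXS.
    apply: eq_bigr => z; rewrite !inE => /andP[zX zY].
    have ei : f z.1 = i by move/subsetP/(_ _ zX): sX; rewrite !inE => /eqP.
    have ej : g z.2 = j by move/subsetP/(_ _ zY): sY; rewrite !inE => /eqP.
    by rewrite /F ei ej bij /inXY ew /= zX zY.
  move=> z; rewrite !inE => /andP[nXY /andP[/eqP ei /eqP ej]].
  by rewrite /F ei ej bij /inXY ew /= (negbTE nXY).
have -> : \sum_(z | (f z.1, g z.2) == (i, j)) (bad (f z.1) (g z.2))%:R / (36 * m ^ 2)%:R =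
    (#|Ai i| * #|Bj j|)%:R / (36 * m ^ 2)%:R :> rat.
  rewrite toXY -cardsX -sum1_card natr_sum mulr_suml; apply: eq_bigr => z.
  by rewrite !inE => /andP[/eqP -> /eqP ->]; rewrite bij.
rewrite sumrB sumr_const -mulr_sumr sumrB sumr_const cardsX.
have -> : \sum_(z in setX X Y) colour_ind c z =
    #|[set p in setX X Y | col p.1 p.2 == c]|%:R.
  rewrite -sum1_card natr_sum [RHS]big_mkcond [LHS]big_mkcond /=.
  apply: eq_bigr => z _; rewrite /colour_ind !inE.
  by case: (_ && _) => //=; case: (_ == _).
set e := #|[set p in _ | _]| in small *; set s := (#|X| * #|Y|)%N in small *.
have e_le : e%:R <= s%:R / 6 :> rat.
  by rewrite ler_pdivlMr // mulrC -natrM ler_nat ltnW.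
have sm : (#|Ai i| * #|Bj j|)%:R / (36 * m ^ 2)%:R <= s%:R / 36 :> rat.
  rewrite ler_pdivrMr ?ltr0n ?muln_gt0 ?expn_gt0 ?m_gt0 //.
  have -> : s%:R / 36 * (36 * m ^ 2)%:R = (s * m ^ 2)%:R :> rat.
    by rewrite !natrM; field.
  by rewrite ler_nat /s (leq_trans (leq_mul lX lY)) // mulnACA mulnC.
(* The gain on a witness rectangle is at least [1/3 * (s/3 - s/6) - s/36 = s/36]. *)
apply: le_trans sm _; rewrite -(mulr_natr (mean c i j)) -(mulr_natr (1 / 36)).
have sM : 1 / 3 * s%:R <= mean c i j * s%:R by rewrite ler_wpM2r // ler0n.
lra.
Qed.

End Regularity.

(** [t] bounds the number of refinements still possible below the maximal energy. A refinement takes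
    [k] clusters per side to at most [k * 2 ^ k], so [K] does not depend on the colouring. *)
Lemma regularity_iterate (m t k : nat) : 0 < m -> exists K, forall (A B L J : finType)
  (col : A -> B -> 'I_3) (f : A -> L) (g : B -> J), #|L| <= k -> #|J| <= k ->
  (3 * (#|A| * #|B|)%:R <= colour_energy col f g +
    t%:R * ((#|A| * #|B|)%:R / (36 * m ^ 3)%:R))%R ->
  exists (L' J' : finType) (f' : A -> L') (g' : B -> J'), [/\ #|L'| <= K, #|J'| <= K &
    m * #|[set p | no_regular_colour f' g' col m (f' p.1) (g' p.2)]| <= #|A| * #|B|].
Proof.
move=> m0; elim: t k => [|t IH] k.
  exists k => A B L J col f g leL leJ le; exists L, J, f, g; split=> //.
  rewrite leqNgt; apply/negP => lt; have [f' [g']] := refine_step m0 lt.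
  have := colour_energy_le col f' g'.
  have AB : (0 < (#|A| * #|B|)%:R :> rat)%R.
    rewrite ltr0n; case: posnP => // e; move: lt; rewrite e.
    rewrite muln_gt0 => /andP[_ /card_gt0P[[x y] _]].
    by move/eqP: e; rewrite muln_eq0 => /orP[] /eqP/card0_eq; [move/(_ x)|move/(_ y)].
  have : (0 < (#|A| * #|B|)%:R / (36 * m ^ 3)%:R :> rat)%R.
    by rewrite divr_gt0 // ltr0n muln_gt0 expn_gt0 m0.
  move: le; set q := (_ / _)%R; lra.
have [K KP] := IH (k * 2 ^ k); exists (maxn k K) => A B L J col f g leL leJ le.
case: (leqP (m * #|[set p | no_regular_colour f g col m (f p.1) (g p.2)]|)
  (#|A| * #|B|)) => [h|lt].
  by exists L, J, f, g; split=> //; rewrite (leq_trans _ (leq_maxl _ _)).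
have [f' [g' gain]] := refine_step m0 lt.
have [|||L' [J' [f'' [g'' [lL lJ h]]]]] := KP _ _ _ _ col f' g'.
- by rewrite card_prod card_ffun card_bool leq_mul // leq_exp2l.
- by rewrite card_prod card_ffun card_bool leq_mul // leq_exp2l.
- move: le gain; rewrite -natr1 mulrDl mul1r; set q := (_ / _)%R; lra.
by exists L', J', f'', g''; split=> //; rewrite (leq_trans _ (leq_maxr _ _)).
Qed.

Lemma regularity (m : nat) : 0 < m -> exists K, forall (A B : finType)
  (col : A -> B -> 'I_3),
  exists (L J : finType) (f : A -> L) (g : B -> J), [/\ #|L| <= K, #|J| <= K &
    m * #|[set p | no_regular_colour f g col m (f p.1) (g p.2)]| <= #|A| * #|B|].
Proof.
(* In units of [#|A| * #|B|] the energy stays between 0 and 3 and rises by [1 / (36 * m ^ 3)] each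
   time. *)
move=> m0; have [K KP] := regularity_iterate (3 * (36 * m ^ 3)) 1 m0.
exists K => A B col; apply: (KP A B unit unit col (fun=> tt) (fun=> tt)).
- by rewrite card_unit.
- by rewrite card_unit.
rewrite -[leLHS]add0r lerD //.
  by apply: sumr_ge0 => c _; apply: sumr_ge0 => z _; apply: sqr_ge0.
have z : ((36 * m ^ 3)%:R != 0 :> rat)%R.
  by rewrite pnatr_eq0 -lt0n muln_gt0 expn_gt0 m0.
by rewrite (natrM _ 3) -mulrA [X in (_ <= _ * X)%R]mulrCA divff // mulr1 lexx.
Qed.

(** * Lifting closed walks of the reduced graph *)

Lemma subset_of_card (T : finType) (S : {set T}) n : n <= #|S| ->
  exists2 S' : {set T}, S' \subset S & #|S'| = n.
Proof.
move=> le; exists [set x in take n (enum S)].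
  by apply/subsetP => x; rewrite inE => /mem_take; rewrite mem_enum.
rewrite cardsE; have /card_uniqP -> := take_uniq n (enum_uniq S).
by rewrite size_takel // -cardE.
Qed.

Lemma add_lt_of_mul_lt m b1 b2 k : 1 < m -> m * b1 < k -> m * b2 < k -> b1 + b2 < k.
Proof.
move=> m1 h1 h2; have : 2 * (b1 + b2) <= m * (b1 + b2) by rewrite leq_mul2r m1 orbT.
by rewrite mulnDr; lia.
Qed.

Section Lift.
Variables (V I : finType) (cl : V -> I) (e : rel V) (rho : rel I) (m c : nat).
Notation cluster i := (cl @^-1: [set i]).
Hypothesis rho_irr : irreflexive rho.
Hypothesis rho_sym : forall i j, rho i j -> rho j i.
Hypothesis e_sym : symmetric e.
Hypothesis c_gt0 : 0 < c.
Hypothesis cm : 6 * c < m.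
Hypothesis dense : forall i j (X Y : {set V}), rho i j ->
  X \subset cluster i -> Y \subset cluster j ->
  #|cluster i| <= m * #|X| -> #|cluster j| <= m * #|Y| ->
  #|X| * #|Y| <= 6 * #|[set p in setX X Y | e p.1 p.2]|.

Definition nbrs v (Y : {set V}) := [set y in Y | e v y].

Definition good v (Y : {set V}) := #|Y| <= 6 * #|nbrs v Y|.

(** Otherwise the bad vertices are numerous enough for [dense], yet each has fewer than a sixth of
    [Y] as neighbours. *)
Lemma card_bad i j (Y : {set V}) : rho i j -> Y \subset cluster j ->
  #|cluster j| <= m * #|Y| -> 0 < #|cluster i| ->
  m * #|[set x in cluster i | ~~ good x Y]| < #|cluster i|.
Proof.
move=> ij sY lY i0; set X := [set x in _ | _]; rewrite ltnNge; apply/negP => lX.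
have sX : X \subset cluster i by apply/subsetP => x; rewrite inE => /andP[].
have X0 : 0 < #|X| by case: #|X| lX; lia.
have := dense ij sX sY lX lY; apply/negP; rewrite -ltnNge.
have -> : #|[set p in setX X Y | e p.1 p.2]| = \sum_(x in X) #|nbrs x Y|.
  rewrite -sum1_card (eq_bigl (fun p => (p.1 \in X) && (p.2 \in nbrs p.1 Y))).
    rewrite -(pair_big_dep (fun x => x \in X) (fun x y => y \in nbrs x Y) (fun _ _ => 1)).
    by apply: eq_bigr => x _; rewrite sum1_card.
  by move=> p; rewrite !inE andbA.
rewrite big_distrr /= -sum_nat_const.
case/card_gt0P: X0 => x0 x0X.
rewrite (bigD1 x0) //= [X in _ < X](bigD1 x0) //= -addSn leq_add //.
  by move: x0X; rewrite !inE /good -ltnNge => /andP[].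
apply: leq_sum => x /andP[]; rewrite !inE /good -ltnNge => /andP[_ /ltnW //].
Qed.

Definition pool (U : {set V}) i := cluster i :\: U.

Lemma good_pool U v w j : cl w != j -> good v (pool U j) -> good v (pool (w |: U) j).
Proof.
move=> ne; have -> // : pool (w |: U) j = pool U j.
apply/setP => x; rewrite !inE negb_or; case: (eqVneq x w) => [->|] //=.
by rewrite (negbTE ne) !andbF.
Qed.

Lemma pool_large U i k :
  c * (#|U :&: cluster i| + k) + #|cluster i| <= c * #|cluster i| ->
  #|cluster i| <= c * #|pool U i|.
Proof. by rewrite /pool cardsD setIC; nia. Qed.

Lemma greedy_walk s v U z : good v (pool U (head z s)) ->
  path rho (cl v) (rcons s z) ->
  (forall k, k \in rcons s z -> 0 < #|cluster k| /\
     c * (#|U :&: cluster k| + count_mem k s) + #|cluster k| <= c * #|cluster k|) ->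
  exists p, [/\ map cl p = s, path e v p, uniq p, {in p, forall y, y \notin U} &
    good (last v p) (pool (U :|: [set y in p]) z)].
Proof.
elim: s v U => [|j s IH] v U gv.
  move=> _ _; exists [::]; split=> //=.
  by have -> : U :|: [set y in [::]] = U by apply/setP => y; rewrite !inE orbF.
move=> /= /andP[vj]; set j' := head z s => pj hk.
have jj' : rho j j' by move: pj; rewrite /j'; case: (s) => [|a l] /= /andP[].
have j'in : j' \in rcons (j :: s) z.
  by rewrite /j'; case: (s) => [|a l] /=; rewrite !inE ?mem_rcons ?inE eqxx ?orbT.
have [j0 lj] := hk j (mem_head _ _); have [j'0 lj'] := hk j' j'in.
have poolj := pool_large lj; have poolj' := pool_large lj'.
have sub i : pool U i \subset cluster i by apply: subsetDl.
have bad := card_bad jj' (sub j') _ j0.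
have {}bad : m * #|[set x in cluster j | ~~ good x (pool U j')]| < #|cluster j|.
  by apply: bad; apply: leq_trans poolj' _; rewrite leq_mul2r; apply/orP; right; lia.
set Bad := [set x in _ | _] in bad.
(* There are at least [#|cluster j| / (6 * c)] neighbours and fewer than [#|cluster j| / m] bad
   vertices. *)
have [x /andP[xN xB]] : exists x, (x \in nbrs v (pool U j)) && (x \notin Bad).
  apply/existsP; rewrite -[X in is_true X]negbK negb_exists; apply/negP => /forallP all.
  have : #|nbrs v (pool U j)| <= #|Bad|.
    apply: subset_leq_card; apply/subsetP => x xN.
    by have := all x; rewrite xN /= negbK.
  move: gv; rewrite /good /=; nia.
move: xN; rewrite !inE => /andP[/andP[xU /eqP xj] vx].
have gx : good x (pool U j') by move: xB; rewrite !inE xj eqxx /= negbK.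
have nej : cl x != j'.
  by apply: contraTneq jj' => <-; rewrite xj rho_irr.
have [||p [ps pp up pU gp]] := IH x (x |: U) (good_pool nej gx).
- by rewrite xj.
- move=> k kin; have [|k0 lk] := hk k; first by rewrite /= inE kin orbT.
  split=> //; apply: leq_trans lk; rewrite /= leq_add2r leq_mul2l.
  apply/orP; right; have : #|(x |: U) :&: cluster k| <= #|U :&: cluster k| + (k == j).
    rewrite setIUl; apply: leq_trans (leq_card_setU _ _) _; rewrite addnC leq_add2l.
    case: eqVneq => [->|ne].
      by rewrite (leq_trans (subset_leq_card (subsetIl _ _))) ?cards1.
    rewrite leqn0 cards_eq0; apply/eqP/setP => y; rewrite !inE.
    by case: eqP => [->|] //=; rewrite xj eq_sym (negbTE ne).
  by rewrite (eq_sym j) addnA leq_add2r.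
exists (x :: p); split=> /=.
- by rewrite xj ps.
- by rewrite vx.
- rewrite up andbT; apply/negP => /pU; by rewrite !inE eqxx.
- move=> y; rewrite inE => /orP[/eqP -> //|/pU]; by rewrite !inE negb_or => /andP[].
- have -> : U :|: [set y in x :: p] = x |: U :|: [set y in p].
    by apply/setP => y; rewrite !inE; case: (y == x); rewrite ?orbT.
  exact: gp.
Qed.

(** The start [v0] is chosen good for the first pool and for a reserved part [R0] of the last
    cluster [b]. After the greedy walk along [s], density between the neighbours of its end in [a]
    and those of [v0] in [R0] yields the closing edge. *)
Lemma lift_closed_walk i0 s a b : cycle rho (i0 :: s ++ [:: a; b]) ->
  (forall k, k \in i0 :: s ++ [:: a; b] -> 0 < #|cluster k| /\
     c * (count_mem k (i0 :: s ++ [:: a; b]) + (#|cluster k| %/ c).+1) + #|cluster k|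
       <= c * #|cluster k|) ->
  exists p : seq V, [/\ size p = (size s).+3, uniq p & cycle e p].
Proof.
move=> cyc load.
have mem_s k : k \in rcons s a -> k \in i0 :: s ++ [:: a; b].
  by rewrite mem_rcons !inE mem_cat !inE => /orP[->|->]; rewrite ?orbT.
have [ai bi ii] : [/\ a \in i0 :: s ++ [:: a; b], b \in i0 :: s ++ [:: a; b] &
    i0 \in i0 :: s ++ [:: a; b]] by rewrite !inE !mem_cat !inE !eqxx !orbT.
have [b0 lb] := load b bi; have [i00 li] := load i0 ii.
have [pth [ab bi0]] : path rho i0 (rcons s a) /\ rho a b /\ rho b i0.
  move: cyc; rewrite /= rcons_cat /= -cat_rcons cat_path last_rcons /=.
  by case/and4P.
(* R0 is kept free for closing the cycle. *)
have [R0 sR0 cR0] : exists2 R0 : {set V}, R0 \subset cluster b &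
    #|R0| = (#|cluster b| %/ c).+1.
  apply: subset_of_card; rewrite -(leq_pmul2l c_gt0); move: lb; rewrite mulnDr.
  by move=> le; apply: leq_trans le; rewrite -addnA addnCA leq_addr.
have rho_ne i j : rho i j -> i != j by apply: contraTneq => ->; rewrite rho_irr.
pose h := head a s.
have ih : rho i0 h by move: pth; rewrite /h; case: (s) => [|x l] /= /andP[].
have hin : h \in rcons s a.
  by rewrite /h; case: (s) => [|x l] /=; rewrite inE eqxx.
have R0k k : #|R0 :&: cluster k| <= (#|cluster k| %/ c).+1.
  have [->|ne] := eqVneq k b; first by rewrite -cR0 subset_leq_card ?subsetIl.
  suff -> : R0 :&: cluster k = set0 by rewrite cards0.
  apply/setP => x; rewrite !inE; apply/negP => /andP[/(subsetP sR0)].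
  by rewrite !inE => /eqP ->; rewrite eq_sym (negbTE ne).
have [h0 lh] := load h (mem_s h hin).
have R0large : #|cluster b| <= c * #|R0| by rewrite cR0 mulnC ltnW // ltn_ceil.
have cm' k : c * k <= m * k.
  by rewrite leq_mul2r (leq_trans _ (ltnW cm)) ?orbT // leq_pmull.
have large k : k \in i0 :: s ++ [:: a; b] -> #|cluster k| <= c * #|pool R0 k|.
  move=> kin; apply: (@pool_large _ _ 0); have [_ lk] := load k kin.
  apply: leq_trans lk; rewrite leq_add2r leq_mul2l addn0.
  by apply/orP; right; apply: leq_trans (R0k k) _; rewrite leq_addl.
have poolsub U k : pool U k \subset cluster k by apply: subsetDl.
have bad1 := card_bad ih (poolsub R0 h) (leq_trans (large _ (mem_s _ hin)) (cm' _)) i00.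
have bad2 := card_bad (rho_sym bi0) sR0 (leq_trans R0large (cm' _)) i00.
set Bad1 := [set x in _ | _] in bad1; set Bad2 := [set x in _ | _] in bad2.
have [v0 /and3P[v0i v01 v02]] :
    exists v0, [&& v0 \in cluster i0, v0 \notin Bad1 & v0 \notin Bad2].
  apply/existsP; rewrite -[X in is_true X]negbK negb_exists; apply/negP => /forallP all.
  have : #|cluster i0| <= #|Bad1| + #|Bad2|.
    apply: leq_trans (leq_card_setU _ _); apply: subset_leq_card; apply/subsetP => x xi.
    by rewrite in_setU; have := all x; rewrite xi /= negb_and !negbK.
  have m1 : 1 < m by apply: leq_trans cm; rewrite ltnS; case: (c) c_gt0.
  by rewrite leqNgt (add_lt_of_mul_lt m1 bad1 bad2).
have clv0 : cl v0 = i0 by move: v0i; rewrite !inE => /eqP.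
have g1 : good v0 (pool R0 h) by move: v01; rewrite !inE clv0 eqxx /= negbK.
have g2 : good v0 R0 by move: v02; rewrite !inE clv0 eqxx /= negbK.
have ne0h : cl v0 != h by rewrite clv0 rho_ne.
have U0k k : #|(v0 |: R0) :&: cluster k| <= (#|cluster k| %/ c).+1 + (k == i0).
  rewrite setIUl; apply: leq_trans (leq_card_setU _ _) _; rewrite addnC leq_add //.
  case: eqVneq => [->|ne].
    by rewrite (leq_trans (subset_leq_card (subsetIl _ _))) ?cards1.
  rewrite leqn0 cards_eq0; apply/eqP/setP => y; rewrite !inE.
  by case: eqP => [->|] //=; rewrite clv0 eq_sym (negbTE ne).
have [||p [ps pp up pU gp]] := greedy_walk (good_pool ne0h g1); first by rewrite clv0.
  move=> k kin; have [k0 lk] := load k (mem_s k kin); split=> //.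
  apply: leq_trans lk; rewrite leq_add2r leq_mul2l; apply/orP; right.
  apply: leq_trans (leq_add (U0k k) (leqnn _)) _.
  by rewrite /= count_cat (eq_sym k); clear; lia.
set U := _ :|: _ in gp; have [a0 la] := load a ai.
have Ua : #|cluster a| <= c * #|pool U a|.
  apply: (@pool_large _ _ 0); apply: leq_trans la; rewrite leq_add2r leq_mul2l addn0.
  apply/orP; right; rewrite /U setIUl.
  apply: leq_trans (leq_card_setU _ _) _.
  have cp : #|[set y in p] :&: cluster a| <= count_mem a s.
    rewrite -ps count_map -size_filter; apply: leq_trans (card_size _).
    by apply: subset_leq_card; apply/subsetP => y; rewrite !inE mem_filter /= andbC.
  apply: leq_trans (leq_add (U0k a) cp) _.
  by rewrite /= count_cat (eq_sym a); clear; lia.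
set x0 := last v0 p in gp.
pose X := nbrs x0 (pool U a); pose R := nbrs v0 R0.
have enlarge w u v : w <= c * u -> u <= 6 * v -> w <= m * v.
  move=> h1 h2; apply: leq_trans h1 (leq_trans (leq_mul (leqnn c) h2) _).
  by rewrite mulnA leq_mul2r mulnC (ltnW cm) orbT.
have Xlarge : #|cluster a| <= m * #|X| by exact: enlarge Ua gp.
have Rlarge : #|cluster b| <= m * #|R| by exact: enlarge R0large g2.
have sX : X \subset cluster a.
  by apply: subset_trans (poolsub U a); apply/subsetP => x; rewrite inE => /andP[].
have sR : R \subset R0 by apply/subsetP => x; rewrite inE => /andP[].
have [[x y] xyP] : exists q, q \in [set q in setX X R | e q.1 q.2].
  apply/set0Pn; rewrite -card_gt0.
  have := dense ab sX (subset_trans sR sR0) Xlarge Rlarge.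
  have pos w k : 0 < w -> w <= m * k -> 0 < k.
    by move=> w0 /(leq_trans w0); rewrite muln_gt0 => /andP[].
  have : 0 < #|X| * #|R| by rewrite muln_gt0 (pos _ _ a0 Xlarge) (pos _ _ b0 Rlarge).
  by move=> pXR /(leq_trans pXR); rewrite muln_gt0.
move: xyP; rewrite !inE /= => /andP[/andP[/andP[/andP[xU xa] x0x] /andP[yR v0y]] exy].
exists (v0 :: rcons (rcons p x) y); split.
- by rewrite /= !size_rcons -ps size_map.
- move: xU; rewrite !negb_or => /andP[/andP[xv0 xR0] xp].
  have yR0 : y \in R0 by [].
  have clne w w' : cl w != cl w' -> w != w' by apply: contraNneq => ->.
  have yb : cl y = b by move/subsetP/(_ _ yR0): sR0; rewrite !inE => /eqP.
  rewrite /= !rcons_uniq up !(mem_rcons, inE) !negb_or xp (eq_sym v0 x) xv0 /= ?andbT.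
  rewrite clne /=; last by rewrite clv0 yb eq_sym rho_ne.
  rewrite clne /=; last by rewrite yb (eqP xa) eq_sym rho_ne.
  by apply/andP; split; apply/negP => /pU; rewrite !inE ?eqxx ?yR0 ?orbT.
- by rewrite /= !rcons_path pp !last_rcons /= -/x0 x0x exy e_sym v0y.
Qed.
End Lift.

(** * Closed walks of prescribed length and load *)

Section ClosedWalks.
Variables (I : finType) (rho : rel I).
Hypothesis rho_sym : symmetric rho.

Definition closed_walk i w := path rho i w && (last i w == i).

Lemma closed_walk_cat i w1 w2 :
  closed_walk i w1 -> closed_walk i w2 -> closed_walk i (w1 ++ w2).
Proof.
case/andP=> p1 /eqP l1 /andP[p2 /eqP l2].
by rewrite /closed_walk cat_path last_cat p1 l1 p2 l2 eqxx.
Qed.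

(** Walk along a simple path to [k] and back. *)
Lemma excursion i k : connect rho i k ->
  exists w n, [/\ closed_walk i w, size w = n.*2, n <= #|I| & k \in i :: w].
Proof.
case/connectP=> p0 pp0; case/shortenP: pp0 => p pp up _ ->.
exists (p ++ rev (belast i p)), (size p); split.
- rewrite /closed_walk cat_path pp last_cat rev_path /=.
  rewrite (eq_path (e' := rho)) ?pp /=; last by move=> x y; rewrite rho_sym.
  by case: p {pp up} => //= x p; rewrite rev_cons last_rcons.
- by rewrite size_cat size_rev size_belast addnn.
- by have := max_card [in i :: p]; rewrite (card_uniqP up) /=; exact: ltnW.
- by rewrite -cat_cons mem_cat mem_last.
Qed.

Lemma grand_tour i (ks : seq I) : {in ks, forall k, connect rho i k} ->
  exists w n, [/\ closed_walk i w, size w = n.*2, n <= size ks * #|I| &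
    {in ks, forall k, k \in i :: w}].
Proof.
elim: ks => [|k ks IH] con; first by exists [::], 0; split; rewrite /closed_walk ?eqxx.
have [|w [n [cw sw nw hw]]] := IH.
  by move=> z zks; apply: con; rewrite inE zks orbT.
have [w' [n' [cw' sw' nw' kw']]] := excursion (con k (mem_head _ _)).
exists (w' ++ w), (n' + n); split.
- exact: closed_walk_cat.
- by rewrite size_cat sw sw' doubleD.
- by rewrite mulSn leq_add.
move=> z; rewrite inE => /orP[/eqP ->|/hw].
  by rewrite -cat_cons mem_cat kw'.
by rewrite !inE mem_cat => /orP[->|->]; rewrite ?orbT.
Qed.

Lemma insert_zigzag i w a b : closed_walk i w -> a \in i :: w -> rho a b ->
  exists w', [/\ closed_walk i w', size w' = (size w).+2, {subset i :: w <= i :: w'} &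
    forall k, count_mem k w' = count_mem k w + (k == a) + (k == b)].
Proof.
move=> cw aw ab; have [w1 [w2 [ew la]]] : exists w1 w2, w = w1 ++ w2 /\ a = last i w1.
  by case/splitPl: aw => w1 w2 la; exists w1, w2.
exists (w1 ++ [:: b; a] ++ w2); move: cw; rewrite ew /closed_walk.
rewrite !cat_path !last_cat /= -la => /andP[/andP[-> ->] ->]; split.
- by rewrite ab rho_sym ab.
- by rewrite !size_cat /= !addnS.
- by move=> z; rewrite !inE !mem_cat /= !inE; case/or3P => ->; rewrite ?orbT.
- move=> k; rewrite !count_cat /= (eq_sym b) (eq_sym a); lia.
Qed.

Lemma insert_zigzags i w (es : seq (I * I)) : closed_walk i w ->
  {in es, forall e, (e.1 \in i :: w) && rho e.1 e.2} ->
  exists w', [/\ closed_walk i w', size w' = size w + (size es).*2 &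
    forall k, count_mem k w' =
      count_mem k w + count (fun e => e.1 == k) es + count (fun e => e.2 == k) es].
Proof.
elim: es w => [|e es IH] w cw hes.
  by exists w; split=> // [|k]; rewrite ?addn0.
have /andP[ew ee] := hes e (mem_head _ _).
have [w1 [cw1 sw1 sub c1]] := insert_zigzag cw ew ee.
have [|w2 [cw2 sw2 c2]] := IH w1 cw1.
  move=> e' e'in; have /andP[h ->] := hes e' (mem_behead (s := e :: es) e'in).
  by rewrite (sub _ h).
exists w2; split=> // [|k]; first by rewrite sw2 sw1 /= doubleS; lia.
by rewrite c2 c1 /= (eq_sym k e.1) (eq_sym k e.2); lia.
Qed.

(** A tour of the whole component passes through the first end of every pair in [es]; zigzags along
    [n - n0] of these pairs, each of length 2, then adjust the length. The tour causes the last term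
    of the load. *)
Lemma closed_walk_length i (es : seq (I * I)) n :
  {in es, forall e, connect rho i e.1 && rho e.1 e.2} ->
  n <= size es -> #|I| * #|I| <= n ->
  exists w, [/\ closed_walk i w, size w = n.*2 & forall k, count_mem k w <=
    count (fun e => e.1 == k) es + count (fun e => e.2 == k) es + (#|I| * #|I|).*2].
Proof.
move=> hes nes In.
have [|w0 [n0 [cw0 sw0 nw0 hw0]]] := @grand_tour i (enum (connect rho i)).
  by move=> k; rewrite mem_enum.
have n0I : n0 <= #|I| * #|I|.
  by apply: leq_trans nw0 _; rewrite leq_mul2r -cardE max_card orbT.
pose es' := take (n - n0) es.
have [|w [cw sw hc]] := @insert_zigzags i w0 es' cw0.
  move=> e /mem_take /hes /andP[ce ->]; rewrite andbT; apply: hw0.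
  by rewrite mem_enum.
exists w; split=> // [|k].
  by rewrite sw sw0 size_takel; lia.
rewrite hc.
have c0 : count_mem k w0 <= (#|I| * #|I|).*2.
  by apply: leq_trans (count_size _ _) _; rewrite sw0 leq_double.
have ct P : count P es' <= count P es.
  by rewrite -[X in _ <= count _ X](cat_take_drop (n - n0)) count_cat leq_addr.
by rewrite -addnA addnC leq_add ?leq_add ?ct.
Qed.
End ClosedWalks.

(** * The upper bound *)

Lemma has_copy_cycle (G : sgraph) (p : seq G) : uniq p -> cycle (@adj G) p ->
  1 < size p -> has_copy (cycle_graph (size p)) G.
Proof.
case: p => // x q up cp _; set p := x :: q in up cp *.
have step (i : 'I_(size p)) : adj (nth x p i) (nth x p (ordS i)).
  have i_lt : i < size (rcons q x) by rewrite size_rcons; exact: (ltn_ord i).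
  have := pathP x cp i i_lt; rewrite -rcons_cons nth_rcons -/p ltn_ord nth_rcons /=.
  case: (ltngtP i (size q)) => [lt|gt|e].
  - by rewrite modn_small // ltnS.
  - by have := ltn_ord i; rewrite ltnS leqNgt gt.
  - by rewrite e modnn.
exists (fun i => nth x p (i : 'I_(size p))); split.
  by move=> i j /eqP; rewrite nth_uniq // => /eqP /val_inj.
move=> i j /= /andP[_ /orP[/eqP ->|/eqP ->]]; first exact: step.
by rewrite adj_sym; exact: step.
Qed.

(** Three sets are deleted, each at most a fraction [1 / s] of [A]: the clusters below size [B], the
    vertices with large [D] (Markov's inequality), and a fraction [1 / s] of every cluster, which is
    the slack for lifting the walk. *)
Lemma trim_side (A L : finType) (f : A -> L) (s B K : nat) (D : A -> nat) :
  0 < s -> 0 < #|A| -> #|L| <= K -> s * (K * B) <= #|A| ->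
  s * s * \sum_x D x <= #|A| * #|A| ->
  exists SA : {set A}, [/\
    forall x, x \in SA -> B <= #|f @^-1: [set f x]| /\ s * D x <= #|A|,
    forall i, #|SA :&: f @^-1: [set i]| <= #|f @^-1: [set i]| - #|f @^-1: [set i]| %/ s &
    s * #|A| <= s * #|SA| + 3 * #|A|].
Proof.
move=> s0 A0 LK KB sD; pose cl i := f @^-1: [set i].
have cut_ex i : exists S : {set A}, S \subset cl i /\ #|S| = #|cl i| - #|cl i| %/ s.
  by have [S sS cS] := subset_of_card (leq_subr (#|cl i| %/ s) #|cl i|); exists S.
have [T TP] := boolp.choice cut_ex.
pose small := [set x | #|cl (f x)| < B].
pose high := [set x | #|A| < s * D x].
pose cut := [set x | x \notin T (f x)].
have split_card (S : {set A}) : #|S| = \sum_i #|S :&: cl i|.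
  rewrite -sum1_card (partition_big f predT) //=; apply: eq_bigr => i _.
  by rewrite -sum1_card; apply: eq_bigl => x; rewrite !inE.
have csmall : #|small| <= K * B.
  rewrite split_card; apply: leq_trans (_ : \sum_(i : L) B <= _); last first.
    by rewrite sum_nat_const leq_mul2r LK orbT.
  apply: leq_sum => i _; case: (set_0Vmem (small :&: cl i)) => [->|[x]].
    by rewrite cards0.
  rewrite !inE => /andP[lt /eqP fx]; rewrite fx in lt.
  exact: leq_trans (subset_leq_card (subsetIr _ _)) (ltnW lt).
have chigh : s * #|high| <= #|A|.
  rewrite -(leq_pmul2r A0); apply: leq_trans sD; rewrite -!mulnA leq_mul2l.
  apply/orP; right; rewrite -sum1_card big_distrl big_distrr /= big_mkcond /=.
  by apply: leq_sum => x _; rewrite inE mul1n; case: ltnP => // /ltnW.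
have ccut : s * #|cut| <= #|A|.
  rewrite split_card -cardsT (split_card setT) big_distrr /=.
  apply: leq_sum => i _; rewrite setTI.
  have -> : cut :&: cl i = cl i :\: T i.
    apply/setP => x; rewrite !inE andbC; case: eqP => [->|]; rewrite ?andbT ?andbF //.
  have [sT cT] := TP i; rewrite cardsD (setIidPr sT) cT subKn ?leq_div //.
  by rewrite mulnC leq_trunc_div.
exists (~: (small :|: high :|: cut)); split.
- move=> x; rewrite !inE !negb_or -!leqNgt => /andP[/andP[xs xh] _].
  by split.
- move=> i; have [sT <-] := TP i; apply: subset_leq_card; apply/subsetP => x.
  by rewrite !inE !negb_or negbK => /andP[/andP[_ xT] /eqP <-].
have := cardsC (small :|: high :|: cut).
have c1 := leq_card_setU (small :|: high) cut.
have c2 := leq_card_setU small high.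
have : s * #|small :|: high :|: cut| <= 3 * #|A|.
  apply: leq_trans (_ : s * (#|small| + #|high| + #|cut|) <= _).
    by rewrite leq_mul2l; apply/orP; right; apply: leq_trans c1 _; rewrite leq_add2r c2.
  have : s * #|small| <= s * (K * B) by rewrite leq_mul2l csmall orbT.
  by rewrite !mulnDr; lia.
by move=> h e; rewrite -{1}e mulnDr addnC leq_add2l.
Qed.

(** * The reduced graph *)

Section Reduced.
Variables (N : nat) (col : colouring N 3) (L J : finType).
Variables (f : 'I_N -> L) (g : 'I_N -> J) (m B : nat).

Definition cluster_of (v : 'I_N + 'I_N) : L + J :=
  match v with inl x => inl (f x) | inr y => inr (g y) end.

(** The size conditions make every non-isolated cluster large enough for [load_bound]. *)
Definition reduced (a : 'I_3) (u v : L + J) : bool :=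
  match u, v with
  | inl i, inr j | inr j, inl i =>
    [&& lower_regular f g (fun x y => col (x, y) == a) m i j,
        B <= #|f @^-1: [set i]| & B <= #|g @^-1: [set j]|]
  | _, _ => false
  end.

Lemma reduced_sym a : symmetric (reduced a).
Proof. by case=> [i|j] [i'|j']. Qed.

Lemma reduced_irr a : irreflexive (reduced a).
Proof. by case. Qed.

Lemma card_cluster_inl i :
  #|cluster_of @^-1: [set inl i]| = #|f @^-1: [set i]|.
Proof.
rewrite -(card_imset _ (@inl_inj 'I_N 'I_N)); apply: eq_card => v.
apply/idP/imsetP => [|[x xi ->]]; last by move: xi; rewrite !inE /= => /eqP ->.
by case: v => [x|y]; rewrite !inE // => e; exists x; rewrite ?inE.
Qed.

Lemma card_cluster_inr j :
  #|cluster_of @^-1: [set inr j]| = #|g @^-1: [set j]|.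
Proof.
rewrite -(card_imset _ (@inr_inj 'I_N 'I_N)); apply: eq_card => v.
apply/idP/imsetP => [|[x xi ->]]; last by move: xi; rewrite !inE /= => /eqP ->.
by case: v => [x|y]; rewrite !inE // => e; exists y; rewrite ?inE.
Qed.

Lemma reduced_dense_lr a i j (X Y : {set 'I_N + 'I_N}) : reduced a (inl i) (inr j) ->
  X \subset cluster_of @^-1: [set inl i] -> Y \subset cluster_of @^-1: [set inr j] ->
  #|cluster_of @^-1: [set inl i]| <= m * #|X| ->
  #|cluster_of @^-1: [set inr j]| <= m * #|Y| ->
  #|X| * #|Y| <= 6 * #|[set p in setX X Y | colour_adj col a p.1 p.2]|.
Proof.
rewrite card_cluster_inl card_cluster_inr => /and3P[reg _ _] sX sY lX lY.
pose X' := inl @^-1: X : {set 'I_N}; pose Y' := inr @^-1: Y : {set 'I_N}.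
have cX : #|X| = #|X'|.
  rewrite -(card_imset _ (@inl_inj 'I_N 'I_N)); apply: eq_card => v.
  apply/idP/imsetP => [vX|[x xX ->]]; last by move: xX; rewrite inE.
  have := subsetP sX _ vX; case: v vX => [x|y] xX; rewrite !inE // => _.
  by exists x; rewrite ?inE.
have cY : #|Y| = #|Y'|.
  rewrite -(card_imset _ (@inr_inj 'I_N 'I_N)); apply: eq_card => v.
  apply/idP/imsetP => [vY|[y yY ->]]; last by move: yY; rewrite inE.
  have := subsetP sY _ vY; case: v vY => [x|y] yY; rewrite !inE // => _.
  by exists y; rewrite ?inE.
move/forallP/(_ X')/forallP/(_ Y')/implyP: reg.
rewrite cX cY in lX lY *; rewrite lX lY !andbT => /(_ _)/leq_trans; apply.
  apply/andP; split; apply/subsetP => x; rewrite !inE => h.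
    by have := subsetP sX _ h; rewrite !inE.
  by have := subsetP sY _ h; rewrite !inE.
rewrite leq_mul2l /=; pose h (p : 'I_N * 'I_N) : ('I_N + 'I_N) * ('I_N + 'I_N) :=
  (inl p.1, inr p.2).
have hinj : injective h by move=> [x y] [x' y'] [-> ->].
rewrite -(card_imset _ hinj); apply: subset_leq_card; apply/subsetP => q.
case/imsetP => -[x y]; rewrite !inE /= => /andP[/andP[xX yY] e] ->.
by rewrite /= xX yY.
Qed.

Lemma reduced_dense a u v (X Y : {set 'I_N + 'I_N}) : reduced a u v ->
  X \subset cluster_of @^-1: [set u] -> Y \subset cluster_of @^-1: [set v] ->
  #|cluster_of @^-1: [set u]| <= m * #|X| ->
  #|cluster_of @^-1: [set v]| <= m * #|Y| ->
  #|X| * #|Y| <= 6 * #|[set p in setX X Y | colour_adj col a p.1 p.2]|.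
Proof.
case: u v => [i|j] [i'|j'] // uv sX sY lX lY.
  exact: reduced_dense_lr uv sX sY lX lY.
have := reduced_dense_lr (a := a) uv sY sX lY lX; rewrite mulnC => /leq_trans; apply.
rewrite leq_mul2l /=; pose h (p : ('I_N + 'I_N) * ('I_N + 'I_N)) := (p.2, p.1).
have hinj : injective h by move=> [x y] [x' y'] [-> ->].
rewrite -(card_imset _ hinj); apply: subset_leq_card; apply/subsetP => q.
case/imsetP => -[x y]; rewrite !inE /= => /andP[/andP[xY yX] e] ->.
by rewrite /= xY yX colour_adj_sym.
Qed.
End Reduced.

(** The slack [v / s] of a cluster of size [v] splits into [v / (4 * s)] reserved, as much kept
    free, and [v / (2 * s)] for [C] and rounding. *)
Lemma load_bound s C v count : 0 < s -> 2 * s * (C + 3) <= v ->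
  count <= v - v %/ s + C ->
  4 * s * (count + (v %/ (4 * s)).+1) + v <= 4 * s * v.
Proof.
move=> s0 big le.
have h1 : 4 * s * (v %/ (4 * s)) <= v by rewrite mulnC leq_trunc_div.
have h2 : v <= s * (v %/ s) + s.
  by rewrite {1}(divn_eq v s) mulnC leq_add2l ltnW // ltn_mod.
have h3 : v %/ s <= v by rewrite leq_div.
have h4 : s * count <= s * (v - v %/ s) + s * C by rewrite -mulnDr leq_mul2l le orbT.
have e : s * (v - v %/ s) + s * (v %/ s) = s * v by rewrite -mulnDr subnK.
have {}big : 2 * (s * C) + 6 * s <= v by move: big; rewrite mulnDr -!mulnA; lia.
have -> : 4 * s * (count + (v %/ (4 * s)).+1) =
    4 * (s * count) + 4 * s * (v %/ (4 * s)) + 4 * s.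
  by rewrite addnS mulnS mulnDr -!mulnA; lia.
rewrite -[4 * s * v]mulnA -e; move: h1 h2 h4 big.
move: (s * count) (4 * s * _) (s * (v - _)) (s * (v %/ s)) (s * C) => x1 x2 x3 x4 x5.
lia.
Qed.

Lemma count_inj_image (T X I : finType) (M : {set T}) (h : T -> X) (S : {set X})
    (f : X -> I) i : {in M &, injective h} -> (forall p, p \in M -> h p \in S) ->
  count (fun p => f (h p) == i) (enum M) <= #|S :&: f @^-1: [set i]|.
Proof.
move=> inj sM; rewrite -size_filter.
have u : uniq [seq h p | p <- enum M & f (h p) == i].
  rewrite map_inj_in_uniq; first exact: filter_uniq (enum_uniq _).
  move=> p q; rewrite mem_filter mem_enum => /andP[_ pM].
  by rewrite mem_filter mem_enum => /andP[_ qM]; exact: inj.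
rewrite -(size_map h) -(card_uniqP u); apply: subset_leq_card; apply/subsetP => x.
case/mapP => p; rewrite mem_filter mem_enum => /andP[fp pM] ->.
by rewrite !inE sM.
Qed.

Lemma bip_arrows_cycle r : 0 < r -> exists n0, forall n N, n0 <= n ->
  (3 * r).+1 * n <= r * N -> bip_arrows N 3 (cycle_graph (2 * n)).
Proof.
(* Trimming loses [3 * N / s] and non-neighbours cost [9 * N / s]; together they fill the
   [N / (3 * r + 1)] that [3 * n] leaves. The square [m] serves the trimming and exceeds
   [24 * s]. *)
move=> r0; pose s := 12 * (3 * r).+1; pose m := s * s.
have s0 : 0 < s by rewrite muln_gt0.
have m0 : 0 < m by rewrite muln_gt0 s0.
have [K KP] := regularity m0.
(* [C] bounds the load of the tour, since there are at most [2 * K] clusters; [B] is the threshold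
   of [load_bound]. *)
pose C := 8 * (K * K); pose B := 2 * s * (C + 3).
exists (s * (K * B) + 4 * (K * K) + 2) => n N n0n nN c.
have n_gt1 : 1 < n by apply: leq_trans n0n; rewrite leq_addl.
have nN' : n <= N.
  rewrite -(leq_pmul2l r0); apply: leq_trans nN; rewrite leq_mul2r; apply/orP; right; lia.
have [L [J [f [g [LK JK bad]]]]] := KP _ _ (fun x y => c (x, y)).
pose irr i j := no_regular_colour f g (fun x y => c (x, y)) m i j.
have sKB : s * (K * B) <= N.
  by apply: leq_trans nN'; apply: leq_trans n0n; rewrite -addnA leq_addr.
have sumA : \sum_x #|[set y | irr (f x) (g y)]| = #|[set p | irr (f p.1) (g p.2)]|.
  rewrite -sum1_card (eq_bigl (fun p => irr (f p.1) (g p.2))); last first.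
    by move=> p; rewrite inE.
  rewrite -(pair_big_dep xpredT (fun x y => irr (f x) (g y)) (fun _ _ => 1)) /=.
  by apply: eq_bigr => x _; rewrite sum1dep_card.
have sumB : \sum_y #|[set x | irr (f x) (g y)]| = #|[set p | irr (f p.1) (g p.2)]|.
  rewrite -sumA; under eq_bigr do rewrite -sum1dep_card big_mkcond.
  rewrite exchange_big /=; apply: eq_bigr => x _.
  by rewrite -sum1dep_card [RHS]big_mkcond.
rewrite !card_ord in bad.
have [||||SA [SA1 SA2 SA3]] := @trim_side _ _ f s B K
  (fun x => #|[set y | irr (f x) (g y)]|) s0.
- by rewrite card_ord; lia.
- exact: LK.
- by rewrite card_ord.
- by rewrite sumA !card_ord.
have [||||SB [SB1 SB2 SB3]] := @trim_side _ _ g s B K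
  (fun y => #|[set x | irr (f x) (g y)]|) s0.
- by rewrite card_ord; lia.
- exact: JK.
- by rewrite card_ord.
- by rewrite sumB !card_ord.
rewrite !card_ord in SA3 SB3.
pose rho a := reduced c f g m B a.
have csym a : connect_sym (rho a) by apply: sym_connect_sym; exact: reduced_sym.
pose colr x y : 'I_3 := odflt ord0
  [pick a | lower_regular f g (fun x y => c (x, y) == a) m (f x) (g y)].
(* Vertices are labelled by the component of their cluster, so a connected matching stays in one
   component of the reduced graph. *)
pose la k x := fingraph.root (rho (inord k)) (inl (f x)).
pose lb k y := fingraph.root (rho (inord k)) (inr (g y)).
have edge x y : x \in SA -> y \in SB -> ~~ irr (f x) (g y) ->
    rho (colr x y) (inl (f x)) (inr (g y)).
  move=> xS yS; rewrite /irr /no_regular_colour negb_forall => /existsP[a].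
  rewrite negbK /rho /= /colr => ha; case: pickP => [b hb|/(_ a)]; last by rewrite ha.
  by rewrite /= hb; have [-> _] := SA1 x xS; have [-> _] := SB1 y yS.
have size_cond (S : {set 'I_N}) : s * N <= s * #|S| + 3 * N ->
    3 * n + 9 * (N %/ s) <= #|S|.
  move=> h; rewrite -(leq_pmul2l s0).
  have h1 : s * (N %/ s) <= N by rewrite mulnC leq_trunc_div.
  have h2 : s * n <= 12 * (r * N) by rewrite /s -mulnA leq_mul2l nN orbT.
  have h3 : s * N = 36 * (r * N) + 12 * N by rewrite /s; lia.
  move: h h1 h2 h3; rewrite mulnDr !(mulnCA s).
  by move: (s * _) (s * _) (s * _) => *; lia.
have [||||||a [i [M [[M1 M2] nM MP]]]] := @connected_matching _ _ _ SA SB la lb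
  (fun x y => colr x y) (fun x y => ~~ irr (f x) (g y)) n (N %/ s).
- exact: ltnW.
- move=> x y xS yS Exy; split; first exact: ltn_ord.
  rewrite /la /lb inord_val; apply/eqP; rewrite root_connect //.
  by apply: connect1; exact: edge.
- move=> x xS; have [_ h] := SA1 x xS; rewrite leq_divRL // mulnC.
  rewrite card_ord in h; apply: leq_trans h; rewrite leq_mul2l; apply/orP; right.
  by apply: subset_leq_card; apply/subsetP => y; rewrite !inE negbK => /andP[].
- move=> y yS; have [_ h] := SB1 y yS; rewrite leq_divRL // mulnC.
  rewrite card_ord in h; apply: leq_trans h; rewrite leq_mul2l; apply/orP; right.
  by apply: subset_leq_card; apply/subsetP => x; rewrite !inE negbK => /andP[].
- exact: size_cond.
- exact: size_cond.
have [p0 p0M] : exists p0, p0 \in M.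
  by apply/set0Pn; rewrite -card_gt0; apply: leq_trans nM; exact: ltnW.
pose i0 : L + J := inl (f p0.1).
pose es : seq ((L + J) * (L + J)) := [seq (inl (f p.1), inr (g p.2)) | p <- enum M].
have a3 : a < 3 by have [_ _ _ <- _] := MP _ p0M; exact: ltn_ord.
pose a' : 'I_3 := inord a.
have hes : {in es, forall e, connect (rho a') i0 e.1 && rho a' e.1 e.2}.
  move=> e /mapP[p]; rewrite mem_enum => pM -> /=.
  have [pA pB Ep pa pi] := MP p pM; have [_ _ _ _ pi0] := MP p0 p0M.
  have e1 : a' = colr p.1 p.2 by apply: val_inj; rewrite /= inordK.
  apply/andP; split; last by rewrite e1; exact: edge.
  by rewrite -root_connect //; apply/eqP; rewrite -/(la a p.1) -/(la a p0.1) pi pi0.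
have II : #|{: L + J}| * #|{: L + J}| <= 4 * (K * K).
  have h : #|{: L + J}| <= 2 * K by rewrite card_sum mul2n -addnn leq_add.
  by apply: leq_trans (leq_mul h h) _; rewrite mulnACA.
have [||w [cw sw hw]] := @closed_walk_length _ (rho a')
  (@reduced_sym _ _ _ _ _ _ _ _ a') i0 es n hes.
- by rewrite size_map -cardE.
- by apply: leq_trans II _; apply: leq_trans n0n; rewrite addnAC leq_addl.
have load k : count_mem k w <= #|cluster_of f g @^-1: [set k]| -
    #|cluster_of f g @^-1: [set k]| %/ s + C.
  apply: leq_trans (hw k) _; apply: leq_add; last first.
    by rewrite /C -[8]/(2 * 4) -mulnA -mul2n leq_mul2l II orbT.
  rewrite !count_map; case: k => [k|k].
    rewrite card_cluster_inl [X in _ + X](_ : _ = 0) ?addn0; last first.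
      by rewrite -[RHS](count_pred0 (enum M)); apply: eq_count.
    apply: leq_trans (SA2 k); rewrite (eq_count (a2 := fun p => f p.1 == k)) //.
    by apply: (count_inj_image (h := fst)) => // p /MP[].
  rewrite card_cluster_inr [X in X + _](_ : _ = 0) ?add0n; last first.
    by rewrite -[RHS](count_pred0 (enum M)); apply: eq_count.
  apply: leq_trans (SB2 k); rewrite (eq_count (a2 := fun p => g p.2 == k)) //.
  by apply: (count_inj_image (h := snd)) => // p /MP[].
(* A closed walk omits its start and ends in it; moving this end to the front gives the cyclic
   list. *)
have [w' ew] : exists w', w = rcons w' i0.
  case/andP: cw => _; case: (lastP w) sw => [|w' x] /=; first by case: (n) n_gt1.
  by rewrite last_rcons => _ /eqP ->; exists w'.
have cyc : cycle (rho a') (i0 :: w') by move: cw; rewrite ew => /andP[].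
have [t [x [y ew']]] : exists t x y, w' = t ++ [:: x; y].
  have : size w' = n.*2.-1 by rewrite -sw ew size_rcons.
  case: (lastP w') => [|w1 y]; first by case: (n) n_gt1 => [|[|]].
  case: (lastP w1) => [|w2 x]; first by case: (n) n_gt1 => [|[|]].
  by move=> _; exists w2, x, y; rewrite -!cats1 -catA.
rewrite ew' in cyc ew.
have rs u v : rho a' u v -> rho a' v u by rewrite /rho reduced_sym.
have cm : 6 * (4 * s) < m by rewrite mulnA ltn_pmul2r // /s; lia.
have s40 : 0 < 4 * s by rewrite muln_gt0.
have [|p [sp up cp]] := lift_closed_walk (@reduced_irr _ _ _ _ _ _ _ _ a') rs
  (@colour_adj_sym _ _ c a') s40 cm (@reduced_dense _ _ _ _ _ _ _ _ a') cyc.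
  move=> k kin.
  have Bk : B <= #|cluster_of f g @^-1: [set k]|.
    have := next_cycle cyc kin; case: (k) (next _ _) => [i'|j'] [i''|j''] //=.
      by rewrite card_cluster_inl => /and3P[].
    by rewrite card_cluster_inr => /and3P[].
  split; first by apply: leq_trans Bk; rewrite /B muln_gt0 muln_gt0 s0 addn3.
  have -> : count_mem k (i0 :: t ++ [:: x; y]) = count_mem k w.
    by rewrite ew -cats1 count_cat /= addn0 addnC.
  exact: load_bound s0 Bk (load k).
exists a'; have -> : 2 * n = size p.
  by rewrite sp mul2n -sw ew size_rcons size_cat addn2.
apply: (@has_copy_cycle (colour_class c a') p) => //.
by rewrite sp.
Qed.

(** * The limit *)

Lemma bip_arrows_cycle_gt n N : (1 < n)%N -> bip_arrows N 3 (cycle_graph (2 * n)) ->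
  (3 * n.-1 < N)%N.
Proof.
move=> n1 arr; rewrite ltnNge; apply/negP => le.
have k0 : (0 < n.-1)%N by case: n n1 {arr le} => [|[|]].
have [a [h [inj hom]]] := arr (fun p => inord (p.1 %/ n.-1)).
have adjS (i : 'I_(2 * n)) : cycle_adj i (ordS i).
  rewrite /cycle_adj /= eqxx andbT -(inj_eq val_inj) /=.
  have i_lt := ltn_ord i; case: (ltngtP i.+1 (2 * n)) => [lt|gt|e].
  - by rewrite modn_small // neq_ltn ltnSn.
  - by move: gt; rewrite ltnNge i_lt.
  - by rewrite e modnn; move: i_lt e; lia.
have hS i := hom i (ordS i) (adjS i).
pose left (v : 'I_N + 'I_N) := if v is inl _ then true else false.
pose P := [set i | left (h i)].
(* The successor of a right vertex is a left one. *)
have cP : (#|~: P| <= #|P|)%N.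
  rewrite -(card_imset _ (@ordS_inj _)); apply: subset_leq_card; apply/subsetP => j.
  case/imsetP => i; rewrite !inE => nl ->; move: (hS i) nl; rewrite /left.
  by case: (h i) => // ?; case: (h (ordS i)).
have cP' := cardsC P; rewrite card_ord in cP'.
have : (#|P| <= n.-1)%N.
  (* The left vertices of the cycle all have quotient [a] on division by [n.-1], so the remainder
     determines them. *)
  pose q i := if h i is inl x then Ordinal (ltn_pmod x k0) else Ordinal (ltn_pmod 0 k0).
  have qinj : {in P &, injective q}.
    have col i x : h i = inl x -> a = inord (x %/ n.-1).
      move=> hi; have := hS i; rewrite hi /=; case: (h (ordS i)) => // y.
      by move/eqP.
    have lt3 (x : 'I_N) : (x %/ n.-1 < 3)%N.
      by rewrite ltn_divLR //; apply: leq_trans (ltn_ord x) le.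
    move=> i j; rewrite !inE /left /q.
    case hi: (h i) => [x|] //; case hj: (h j) => [y|] //.
    move=> _ _ [e]; apply: inj; rewrite hi hj; congr inl; apply: val_inj => /=.
    rewrite (divn_eq x n.-1) (divn_eq y n.-1) e; congr (_ * _ + _)%N.
    by rewrite -[LHS](inordK (lt3 x)) -[RHS](inordK (lt3 y)) -(col i x hi) -(col j y hj).
  by rewrite -(card_in_imset qinj) -[X in (_ <= X)%N](card_ord n.-1) max_card.
move: cP cP' k0; lia.
Qed.

Lemma bip_ramsey_cycle_bounds r : (0 < r)%N -> exists n0, forall n, (n0 <= n)%N ->
  (3 * n <= bip_ramsey 3 (cycle_graph (2 * n)) + 2)%N /\
  (r * bip_ramsey 3 (cycle_graph (2 * n)) <= (3 * r).+1 * n + r)%N.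
Proof.
move=> r0; have [n0 up] := bip_arrows_cycle r0; exists (n0 + 2)%N => n le.
(* The successor makes up for rounding [n / r] down. *)
have arr : bip_arrows (3 * n + (n %/ r).+1) 3 (cycle_graph (2 * n)).
  apply: (up n _ (leq_trans (leq_addr _ _) le)).
  have := divn_eq n r; have := ltn_mod n r; rewrite r0.
  move: (n %/ r) (n %% r) => q t lt e; nia.
have [N1 N2] := bip_ramseyP arr.
split.
  have n1 : (1 < n)%N by apply: leq_trans le; rewrite leq_addl.
  have := bip_arrows_cycle_gt n1 N1; lia.
have h := N2 _ arr; apply: leq_trans (_ : r * (3 * n + (n %/ r).+1) <= _)%N.
  by rewrite leq_mul2l h orbT.
have := leq_trunc_div n r; move: (n %/ r) => q; nia.
Qed.

From mathcomp Require Import all_classical all_reals all_analysis.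
Import numFieldNormedType.Exports.
Local Open Scope classical_set_scope.
Local Open Scope ring_scope.

Theorem theorem1 (R : realType) :
  ((bip_ramsey 3 (cycle_graph (2 * n)%N))%:R / n%:R : R) @[n --> \oo] --> (3 : R).
Proof.
apply/cvgrPdist_le => e e0.
(* The error [1 / r] of the upper bound is then below [e / 2]. *)
pose r := (Num.truncn (2 / e)).+1; have r0 : (0 < r)%N by [].
have [n0 bounds] := bip_ramsey_cycle_bounds r0.
have re : 1 <= r%:R * (e / 2).
  have : 2 / e < r%:R by apply: truncnS_gt.
  by rewrite ltr_pdivrMr // => h; lra.
near=> n.
have [|lo hi] := bounds n; first by near: n; exact: nbhs_infty_ge.
(* This keeps the additive errors, 2 below and 1 above, at most [e / 2] after division by [n]. *)
have ne : 4 / e <= n%:R by near: n; exact: nbhs_infty_ger.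
have n0' : 0 < n%:R :> R by apply: lt_le_trans ne; rewrite divr_gt0.
rewrite ler_pdivrMr // in ne.
set b := bip_ramsey _ _ in lo hi *.
have {}lo : 3 * n%:R <= b%:R + 2 :> R by rewrite -natrM -natrD ler_nat.
have {}hi : r%:R * b%:R <= (3 * r%:R + 1) * n%:R + r%:R :> R.
  by rewrite -!natrM natr1 -natrM -natrD ler_nat.
have -> : 3 - b%:R / n%:R = (3 * n%:R - b%:R) / n%:R :> R.
  by rewrite mulrBl mulfK // gt_eqF.
rewrite normrM normfV (gtr0_norm n0') ler_pdivrMr // ler_norml.
have r0' : 0 < r%:R :> R by rewrite ltr0n.
apply/andP; split; last by lra.
rewrite -(ler_pM2l r0').
have : 1 * n%:R <= r%:R * (e / 2) * n%:R by rewrite ler_wpM2r // ltW.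
have : r%:R * 4 <= r%:R * (n%:R * e) by rewrite ler_wpM2l // ltW.
move=> h1 h2; nra.
Unshelve. all: by end_near.
Qed.
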